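(* Let $k$ be an algebraically closed field, $A=kQ$ the path algebra of a finite quiver $Q$, $T$ a finite-dimensional left $A$-module with $\mathrm{Ext}^1_A(T,T)=0$, and $B=A[T]$ the one-point extension of $A$ by $T$. Then for full finite-dimensional $A[T]$-modules $\tilde M=(M,V,f:T\otimes_kV\to M)$ and $\tilde N=(N,W,g:T\otimes_kW\to N)$ we have \[ \dim\mathrm{Der}_{\tilde R}\big(B,\mathrm{Hom}_{\tilde R}(\tilde N,\tilde M)\big)=\dim\mathrm{Der}_R\big(A,\mathrm{Hom}_R(N,M)\big)+\dim W\cdot\langle T,M\rangle_A . \]
   Context: $A[T]$ is the $k$-algebra of formal matrices $\begin{pmatrix} a & t\\ 0&\lambda\end{pmatrix}$ with $a\in A$, $t\in T$, $\lambda\in k$, with componentwise addition and formal matrix multiplication. Left $A[T]$-modules are identified with triples $(M,V,f)$ where $M$ is a left $A$-module, $V$ a $k$-vector space and $f:T\otimes_kV\to M$ an $A$-module map; a morphism $(M,V,f)\to(N,W,g)$ is a pair $(\varphi_1:M\to N\text{ $A$-linear},\ \varphi_2:V\to W\text{ $k$-linear})$ with $\varphi_1f=g(\mathrm{id}_T\otimes\varphi_2)$. An $A[T]$-module $(M,V,f)$ is full if $f$ is surjective. $R\subseteq A$ is the semisimple subalgebra spanned by the trivial paths $e_1,\dots,e_n$; $\tilde R\subseteq A[T]$ is the subalgebra spanned by the idempotents $\begin{pmatrix} e_i&0\\0&0\end{pmatrix}$ and $\begin{pmatrix}0&0\\0&1\end{pmatrix}$. $\mathrm{Der}_S(B,\mathrm{Hom}_S(\tilde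 N,\tilde M))$ denotes the $k$-space of derivations $\delta:B\to\mathrm{Hom}_k(\tilde N,\tilde M)$ (for the natural $B$-bimodule structure) vanishing on the subalgebra $S$. $\langle T,M\rangle_A=\dim\mathrm{Hom}_A(T,M)-\dim\mathrm{Ext}^1_A(T,M)$ is the homological Euler form of $A$. *)

(* Defs.v *)
From HB Require Import structures.
From mathcomp Require Import all_boot all_order all_algebra finmap.
From mathcomp.multinomials Require Import monalg.
From mathcomp Require Import boolp classical_sets functions.

Set Implicit Arguments.
Unset Strict Implicit.
Unset Printing Implicit Defensive.

Import GRing.Theory.
Local Open Scope ring_scope.
Local Open Scope quotient_scope.

(* MathComp's [algType] excludes the zero ring, but the path algebra of the
   quiver without vertices is zero: a k-algebra is a ring with a ring morphism
   c |-> c . 1 from k to its centre. *)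
HB.mixin Record PzRing_isKAlgebra (k : pzRingType) A of GRing.PzRing A := {
  kscal : k -> A;
  kscal1 : kscal 1 = 1;
  kscalD : {morph kscal : c d / c + d};
  kscalM : {morph kscal : c d / c * d};
  kscalC : forall (c : k) (x : A), kscal c * x = x * kscal c
}.

#[short(type="kAlgType")]
HB.structure Definition KAlgebra (k : pzRingType) :=
  {A of GRing.PzRing A & PzRing_isKAlgebra k A}.

(* An A-module seen as a k-vector space. *)
Definition kmod (k : fieldType) (A : kAlgType k) (M : lmodType A) : Type := M.

Section RestrictionOfScalars.
Variables (k : fieldType) (A : kAlgType k) (M : lmodType A).

HB.instance Definition _ := GRing.Zmodule.on (kmod M).

Definition kscale (c : k) (m : kmod M) : kmod M := (kscal c : A) *: (m : M).

Lemma kscaleA a b v : kscale a (kscale b v) = kscale (a * b) v.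
Proof. by rewrite /kscale scalerA kscalM. Qed.

Lemma kscale1 : left_id 1 kscale.
Proof. by move=> v; rewrite /kscale kscal1 scale1r. Qed.

Lemma kscaleDr : right_distributive kscale +%R.
Proof. by move=> a u v; rewrite /kscale scalerDr. Qed.

Lemma kscaleDl v : {morph kscale^~ v : a b / a + b}.
Proof. by move=> a b; rewrite /kscale kscalD scalerDl. Qed.

HB.instance Definition _ := GRing.Zmodule_isLmodule.Build k (kmod M)
  kscaleA kscale1 kscaleDr kscaleDl.

Lemma kscaleE (c : k) (m : M) : c *: (m : kmod M) = (kscal c : A) *: m.
Proof. by []. Qed.

Lemma kscale_scaleC (c : k) (a : A) (m : M) :
  c *: (a *: m : kmod M) = a *: (c *: (m : kmod M) : M).
Proof. by rewrite !kscaleE !scalerA kscalC. Qed.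

End RestrictionOfScalars.

(* [subquot_dim Z W d] : for subspaces W <= Z of L, dim (Z / W) = d, i.e. there
   are b_1, .., b_d in Z whose classes form a basis of Z / W. *)
Definition subquot_dim (k : fieldType) (L : lmodType k) (Z W : set L)
    (d : nat) : Prop :=
  exists b : 'I_d -> L, (forall i, Z (b i)) /\
    forall z, Z z -> exists! c : 'rV[k]_d, W (z - \sum_(i < d) c 0 i *: b i).

Definition has_dim (k : fieldType) (L : lmodType k) (Z : set L)
    (d : nat) : Prop :=
  subquot_dim Z [set 0] d.

Definition fin_dim (k : fieldType) (A : kAlgType k) (M : lmodType A) : Prop :=
  exists d, has_dim [set: kmod M] d.

Record quiver := Quiver {
  vertex : finType;
  arrow : finType;
  src : arrow -> vertex;
  tgt : arrow -> vertex
}.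

Section Paths.
Variable Q : quiver.

Fixpoint is_walk (i : vertex Q) (l : seq (arrow Q)) : bool :=
  if l is a :: l' then (src a == i) && is_walk (tgt a) l' else true.

Definition walk_end (i : vertex Q) (l : seq (arrow Q)) : vertex Q :=
  last i (map (@tgt Q) l).

(* A path is its starting vertex together with its arrows, listed in the order
   in which they are traversed. *)
Record qpath := QPath {
  qpath_val : vertex Q * seq (arrow Q);
  _ : is_walk qpath_val.1 qpath_val.2
}.

HB.instance Definition _ := [isSub for qpath_val].
HB.instance Definition _ := [Choice of qpath by <:].

Definition psrc (p : qpath) : vertex Q := (qpath_val p).1.
Definition ptgt (p : qpath) : vertex Q :=
  walk_end (qpath_val p).1 (qpath_val p).2.

Definition ptriv (i : vertex Q) : qpath := @QPath (i, [::]) isT.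

(* The product p q is "first q, then p", so that an arrow i --> j acts on a left
   module M as a map e_i M -> e_j M; it is [None] when q does not end where
   p starts. *)
Definition pcomp (p q : qpath) : option qpath :=
  if ptgt q == psrc p then insub (psrc q, (qpath_val q).2 ++ (qpath_val p).2)
  else None.

Lemma is_walk_cat i l1 l2 :
  is_walk i (l1 ++ l2) = is_walk i l1 && is_walk (walk_end i l1) l2.
Proof.
by elim: l1 i => //= a l1 IH i; rewrite IH andbA.
Qed.

Lemma walk_end_cat i l1 l2 :
  walk_end i (l1 ++ l2) = walk_end (walk_end i l1) l2.
Proof. by rewrite /walk_end map_cat last_cat. Qed.

Lemma pcompP (p q : qpath) :
  if ptgt q == psrc p then
    exists2 r, pcomp p q = Some r & qpath_val r =
      (psrc q, (qpath_val q).2 ++ (qpath_val p).2)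
  else pcomp p q = None.
Proof.
rewrite /pcomp; case: eqP => // e.
have w : is_walk (psrc q) ((qpath_val q).2 ++ (qpath_val p).2).
  rewrite is_walk_cat (valP q) -[walk_end _ _]/(ptgt q) e; exact: (valP p).
case: insubP => [r _ rE|/negP[]]; last exact: w.
by exists r.
Qed.

Lemma pcompA (p q r : qpath) :
  obind (pcomp p) (pcomp q r) = obind (pcomp^~ r) (pcomp p q).
Proof.
have := pcompP q r; have := pcompP p q.
case: (eqVneq (ptgt q) (psrc p)) => [e1 [u -> uE]|n1 ->];
  case: (eqVneq (ptgt r) (psrc q)) => [e2 [v -> vE]|n2 ->] //=.
- have := pcompP p v; have := pcompP u r.
  have -> : ptgt v = psrc p.
    rewrite -e1 /ptgt vE /= walk_end_cat.
    by rewrite -[walk_end _ (qpath_val r).2]/(ptgt r) e2.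
  have -> : psrc u = psrc q by rewrite {1}/psrc uE.
  rewrite e2 !eqxx => -[x -> xE] [y -> yE]; congr Some; apply: val_inj => /=.
  by rewrite xE yE uE vE /= catA /psrc vE.
- have := pcompP u r.
  have -> : psrc u = psrc q by rewrite {1}/psrc uE.
  by rewrite (negbTE n2).
- have := pcompP p v.
  have -> : ptgt v = ptgt q.
    rewrite /ptgt vE /= walk_end_cat.
    by rewrite -[walk_end _ (qpath_val r).2]/(ptgt r) e2.
  by rewrite (negbTE n1).
Qed.

Lemma pcomp_trivl i p :
  pcomp (ptriv i) p = if ptgt p == i then Some p else None.
Proof.
have := pcompP (ptriv i) p; rewrite {1 2}/psrc /=.
case: eqP => // _ [r -> rE]; congr Some; apply: val_inj => /=.
by rewrite rE cats0 /psrc -surjective_pairing.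
Qed.

Lemma pcomp_trivr i p :
  pcomp p (ptriv i) = if psrc p == i then Some p else None.
Proof.
have := pcompP p (ptriv i); rewrite -[ptgt (ptriv i)]/i eq_sym.
case: eqP => // e [r -> rE]; congr Some; apply: val_inj => /=.
by rewrite rE /= -[psrc (ptriv i)]/i -e /psrc -surjective_pairing.
Qed.

End Paths.

(* The path algebra kQ : finitely supported functions on the set of paths. *)
Definition path_alg (k : fieldType) (Q : quiver) : Type := {malg k[qpath Q]}.

HB.instance Definition _ k Q := GRing.Zmodule.on (path_alg k Q).

(* The scaling, the paths and the product are locked only to keep unification
   from unfolding finitely supported functions. *)
HB.lock Definition pa_scale (k : fieldType) (Q : quiver) (c : k)
  (f : path_alg k Q) : path_alg k Q := c *: (f : {malg k[qpath Q]}).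

Section PathAlgebraScale.
Variables (k : fieldType) (Q : quiver).
Local Notation A := (path_alg k Q).

Lemma pa_mcoeffZ_subproof (c : k) (f : A) p : (pa_scale c f)@_p = c * f@_p.
Proof. by rewrite pa_scale.unlock mcoeffZ. Qed.

Lemma pa_scaleA (a b : k) (f : A) :
  pa_scale a (pa_scale b f) = pa_scale (a * b) f.
Proof. by rewrite pa_scale.unlock [LHS]scalerA. Qed.

Lemma pa_scale1 : left_id 1 (@pa_scale k Q).
Proof. by move=> f; rewrite pa_scale.unlock [LHS]scale1r. Qed.

Lemma pa_scaleDr : right_distributive (@pa_scale k Q) +%R.
Proof. by move=> a f g; rewrite pa_scale.unlock [LHS]scalerDr. Qed.

Lemma pa_scaleDl (f : A) : {morph (@pa_scale k Q)^~ f : a b / a + b}.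
Proof. by move=> a b; rewrite pa_scale.unlock [LHS]scalerDl. Qed.

HB.instance Definition _ := GRing.Zmodule_isLmodule.Build k (path_alg k Q)
  pa_scaleA pa_scale1 pa_scaleDr pa_scaleDl.

Lemma pa_mcoeffZ (c : k) (f : A) p : (c *: f)@_p = c * f@_p.
Proof. exact: pa_mcoeffZ_subproof. Qed.

Lemma pa_msuppZ_le (c : k) (f : A) : (msupp (c *: f) `<=` msupp f)%fset.
Proof.
apply/fsubsetP=> p; rewrite -!mcoeff_neq0 pa_mcoeffZ.
by apply/contraTneq=> ->; rewrite mulr0 negbK.
Qed.

End PathAlgebraScale.

HB.lock Definition pa_path (k : fieldType) (Q : quiver) (p : qpath Q) :
  path_alg k Q := << (1 : k) *g p >>.

(* The product p q in kQ, zero when p and q do not compose. *)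
Definition pa_pmul (k : fieldType) (Q : quiver) (p q : qpath Q) :
  path_alg k Q :=
  oapp (@pa_path k Q) 0 (pcomp p q).

HB.lock Definition pa_mul (k : fieldType) (Q : quiver) (f g : path_alg k Q) :
  path_alg k Q :=
  \sum_(p <- msupp f) \sum_(q <- msupp g) (f@_p * g@_q) *: pa_pmul k p q.

Section PathAlgebra.
Variables (k : fieldType) (Q : quiver).
Local Notation A := (path_alg k Q).
Local Notation P := (qpath Q).
Local Notation pa_path := (@pa_path k Q).
Local Notation pa_pmul := (@pa_pmul k Q).
Local Notation pa_mul := (@pa_mul k Q).

Definition pa_one : A := \sum_(i : vertex Q) pa_path (ptriv i).

Lemma pa_mulw (d1 d2 : {fset P}) (f g : A) :
  (msupp f `<=` d1)%fset -> (msupp g `<=` d2)%fset ->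
  pa_mul f g = \sum_(p <- d1) \sum_(q <- d2) (f@_p * g@_q) *: pa_pmul p q.
Proof.
move=> le1 le2; rewrite pa_mul.unlock (big_fset_incl _ le1) /=.
  apply: eq_bigr => p _; apply: big_fset_incl => // q _ /mcoeff_outdom ->.
  by rewrite mulr0 scale0r.
move=> p _ /mcoeff_outdom fp; rewrite big1 // => q _.
by rewrite fp mul0r scale0r.
Qed.

Lemma pa_mulDl : left_distributive pa_mul +%R.
Proof.
move=> f g h.
rewrite (pa_mulw (fsubsetUl (msupp f) (msupp g)) (fsubset_refl (msupp h))).
rewrite (pa_mulw (fsubsetUr (msupp f) (msupp g)) (fsubset_refl (msupp h))).
rewrite (pa_mulw (msuppD_le f g) (fsubset_refl (msupp h))).
rewrite -big_split /=; apply: eq_bigr => p _.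
rewrite -big_split /=; apply: eq_bigr => q _.
by rewrite mcoeffD mulrDl scalerDl.
Qed.

Lemma pa_mulDr : right_distributive pa_mul +%R.
Proof.
move=> h f g.
rewrite (pa_mulw (fsubset_refl (msupp h)) (fsubsetUl (msupp f) (msupp g))).
rewrite (pa_mulw (fsubset_refl (msupp h)) (fsubsetUr (msupp f) (msupp g))).
rewrite (pa_mulw (fsubset_refl (msupp h)) (msuppD_le f g)).
rewrite -big_split /=; apply: eq_bigr => p _.
rewrite -big_split /=; apply: eq_bigr => q _.
by rewrite mcoeffD mulrDr scalerDl.
Qed.

Lemma pa_scaleAl (c : k) f g : c *: pa_mul f g = pa_mul (c *: f) g.
Proof.
rewrite (pa_mulw (pa_msuppZ_le c f) (fsubset_refl (msupp g))) pa_mul.unlock.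
rewrite scaler_sumr.
apply: eq_bigr => p _; rewrite scaler_sumr; apply: eq_bigr => q _.
by rewrite pa_mcoeffZ scalerA mulrA.
Qed.

Lemma pa_scaleAr (c : k) f g : c *: pa_mul f g = pa_mul f (c *: g).
Proof.
rewrite (pa_mulw (fsubset_refl (msupp f)) (pa_msuppZ_le c g)) pa_mul.unlock.
rewrite scaler_sumr.
apply: eq_bigr => p _; rewrite scaler_sumr; apply: eq_bigr => q _.
by rewrite pa_mcoeffZ scalerA mulrCA.
Qed.

Lemma pa_mul0l g : pa_mul 0 g = 0.
Proof. by rewrite -[0 in LHS](scale0r 0) -pa_scaleAl scale0r. Qed.

Lemma pa_mul0r f : pa_mul f 0 = 0.
Proof. by rewrite -[0 in LHS](scale0r 0) -pa_scaleAr scale0r. Qed.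

Lemma pa_mul_suml I (r : seq I) (F : I -> A) g :
  pa_mul (\sum_(i <- r) F i) g = \sum_(i <- r) pa_mul (F i) g.
Proof.
by apply: (big_morph (pa_mul^~ g)) => [x y|]; rewrite ?pa_mulDl ?pa_mul0l.
Qed.

Lemma pa_mul_sumr I (r : seq I) (F : I -> A) f :
  pa_mul f (\sum_(i <- r) F i) = \sum_(i <- r) pa_mul f (F i).
Proof.
by apply: (big_morph (pa_mul f)) => [x y|]; rewrite ?pa_mulDr ?pa_mul0r.
Qed.

Lemma pa_mul_path p q : pa_mul (pa_path p) (pa_path q) = pa_pmul p q.
Proof.
rewrite pa_path.unlock.
rewrite (pa_mulw (msuppU_le (x := 1) (k := p)) (msuppU_le (x := 1) (k := q))).
by rewrite !big_seq_fset1 !mcoeffUU mulr1 scale1r.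
Qed.

Lemma pa_pathE (f : A) : f = \sum_(p <- msupp f) f@_p *: pa_path p.
Proof.
rewrite {1}[f]monalgE; apply: eq_bigr => p _; rewrite pa_path.unlock.
apply/malgP => q; rewrite [RHS]pa_mcoeffZ [LHS]mcoeffU mcoeffU.
by rewrite mulrnAr mulr1.
Qed.

Lemma pa_ind (S : A -> Prop) :
    S 0 -> (forall f g, S f -> S g -> S (f + g)) ->
    (forall c f, S f -> S (c *: f)) -> (forall p, S (pa_path p)) ->
  forall f, S f.
Proof.
move=> S0 SD SZ Sp f; rewrite (pa_pathE f).
by elim/big_ind: _ => // p _; apply: SZ.
Qed.

Lemma pa_mulA : associative pa_mul.
Proof.
move=> f g h; elim/pa_ind: f => [|f1 f2 IH1 IH2|c f IH|p].
- by rewrite !pa_mul0l.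
- by rewrite !(pa_mulDl f1 f2) (pa_mulDl (pa_mul f1 g)) IH1 IH2.
- by rewrite -!(pa_scaleAl c f) -(pa_scaleAl c (pa_mul f g)) IH.
elim/pa_ind: g => [|g1 g2 IH1 IH2|c g IH|q].
- by rewrite pa_mul0l pa_mul0r pa_mul0l.
- rewrite (pa_mulDl g1 g2 h) (pa_mulDr (pa_path p) g1 g2).
  rewrite (pa_mulDr (pa_path p) (pa_mul g1 h) (pa_mul g2 h)).
  rewrite (pa_mulDl (pa_mul (pa_path p) g1) (pa_mul (pa_path p) g2) h).
  by rewrite IH1 IH2.
- rewrite -(pa_scaleAl c g h) -(pa_scaleAr c (pa_path p) g).
  rewrite -(pa_scaleAr c (pa_path p) (pa_mul g h)).
  by rewrite -(pa_scaleAl c (pa_mul (pa_path p) g) h) IH.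
set pq := pa_mul (pa_path p) (pa_path q).
elim/pa_ind: h => [|h1 h2 IH1 IH2|c h IH|r].
- by rewrite !pa_mul0r.
- rewrite (pa_mulDr (pa_path q) h1 h2) (pa_mulDr pq h1 h2) -IH1 -IH2.
  exact: pa_mulDr.
- rewrite -(pa_scaleAr c (pa_path q) h) -(pa_scaleAr c pq h) -IH.
  by rewrite -(pa_scaleAr c (pa_path p) (pa_mul (pa_path q) h)).
rewrite {}/pq.
rewrite !pa_mul_path /pa_pmul; have := pcompA p q r.
case: (pcomp q r) => [u|]; case: (pcomp p q) => [v|] /=;
  rewrite ?pa_mul_path ?pa_mul0l ?pa_mul0r // /pa_pmul.
- by move=> ->.
- by move=> ->.
- by move=> <-.
Qed.

Lemma pa_mul1l : left_id pa_one pa_mul.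
Proof.
move=> f; elim/pa_ind: f => [|f1 f2 IH1 IH2|c f IH|p].
- by rewrite pa_mul0r.
- by rewrite pa_mulDr IH1 IH2.
- by rewrite -pa_scaleAr IH.
rewrite pa_mul_suml (bigD1 (ptgt p)) //= big1 ?addr0 => [|i /negbTE ne].
  by rewrite pa_mul_path /pa_pmul pcomp_trivl eqxx.
by rewrite pa_mul_path /pa_pmul pcomp_trivl eq_sym ne.
Qed.

Lemma pa_mul1r : right_id pa_one pa_mul.
Proof.
move=> f; elim/pa_ind: f => [|f1 f2 IH1 IH2|c f IH|p].
- by rewrite pa_mul0l.
- by rewrite pa_mulDl IH1 IH2.
- by rewrite -pa_scaleAl IH.
rewrite pa_mul_sumr (bigD1 (psrc p)) //= big1 ?addr0 => [|i /negbTE ne].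
  by rewrite pa_mul_path /pa_pmul pcomp_trivr eqxx.
by rewrite pa_mul_path /pa_pmul pcomp_trivr eq_sym ne.
Qed.

HB.instance Definition _ := GRing.Zmodule_isPzRing.Build (path_alg k Q)
  pa_mulA pa_mul1l pa_mul1r pa_mulDl pa_mulDr.

Definition pa_kscal (c : k) : A := c *: pa_one.

Lemma pa_kscal1 : pa_kscal 1 = 1.
Proof. exact: scale1r. Qed.

Lemma pa_kscalD : {morph pa_kscal : c d / c + d}.
Proof. by move=> c d; apply: scalerDl. Qed.

Lemma pa_kscalM : {morph pa_kscal : c d / c * d}.
Proof.
move=> c d; rewrite -[RHS]/(pa_mul _ _) -pa_scaleAl pa_mul1l.
by rewrite /pa_kscal scalerA.
Qed.

Lemma pa_kscalC (c : k) (x : A) : pa_kscal c * x = x * pa_kscal c.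
Proof.
rewrite -[LHS]/(pa_mul _ _) -[RHS]/(pa_mul _ _).
by rewrite -pa_scaleAl -pa_scaleAr pa_mul1l pa_mul1r.
Qed.

HB.instance Definition _ := PzRing_isKAlgebra.Build k (path_alg k Q)
  pa_kscal1 pa_kscalD pa_kscalM pa_kscalC.

Lemma pa_kscalE (c : k) (x : A) : kscal c * x = c *: x.
Proof. by rewrite -[LHS]/(pa_mul _ _) -pa_scaleAl pa_mul1l. Qed.

Definition pa_idem (i : vertex Q) : A := pa_path (ptriv i).

(* R, the span of the trivial paths. *)
Definition vertex_subalg : set A :=
  [set x | exists c : vertex Q -> k, x = \sum_i c i *: pa_idem i].

End PathAlgebra.

Arguments vertex_subalg : clear implicits.

Section Tensor.
Variables (k : fieldType) (A : kAlgType k) (T : lmodType A) (V : lmodType k).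

(* T (x)_k V as formal finite sums of pure tensors modulo the bilinearity
   relations; since - (t, v) is represented by (- t, v), formal sums with
   coefficients in nat suffice. *)
Inductive tensor_eq : seq (T * V) -> seq (T * V) -> Prop :=
| teq_refl x : tensor_eq x x
| teq_sym x y : tensor_eq x y -> tensor_eq y x
| teq_trans x y z : tensor_eq x y -> tensor_eq y z -> tensor_eq x z
| teq_cat x x' y y' :
    tensor_eq x x' -> tensor_eq y y' -> tensor_eq (x ++ y) (x' ++ y')
| teq_catC x y : tensor_eq (x ++ y) (y ++ x)
| teq_0 v : tensor_eq [:: (0, v)] [::]
| teq_Dl t t' v : tensor_eq [:: (t + t', v)] [:: (t, v); (t', v)]
| teq_Dr t v v' : tensor_eq [:: (t, v + v')] [:: (t, v); (t, v')]
| teq_Z (c : k) t v :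
    tensor_eq [:: (c *: (t : kmod T) : T, v)] [:: (t, c *: v)].

Definition tensor_eqb (x y : seq (T * V)) : bool := `[< tensor_eq x y >].

Lemma tensor_eqb_refl : reflexive tensor_eqb.
Proof. by move=> x; apply/asboolP; apply: teq_refl. Qed.

Lemma tensor_eqb_sym : symmetric tensor_eqb.
Proof. by move=> x y; apply/asboolP/asboolP; apply: teq_sym. Qed.

Lemma tensor_eqb_trans : transitive tensor_eqb.
Proof.
by move=> y x z /asboolP xy /asboolP yz; apply/asboolP; apply: teq_trans yz.
Qed.

Canonical tensor_equiv :=
  EquivRel tensor_eqb tensor_eqb_refl tensor_eqb_sym tensor_eqb_trans.

Definition tensor := {eq_quot tensor_equiv}.
HB.instance Definition _ := Choice.on tensor.
HB.instance Definition _ : EqQuotient _ tensor_equiv tensor :=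
  EqQuotient.on tensor.

Definition pure (t : T) (v : V) : tensor := \pi_tensor [:: (t, v)].

Lemma teq_pi x y : tensor_eq x y <-> \pi_tensor x = \pi_tensor y.
Proof.
split=> [xy|/eqP]; first by apply/eqP; rewrite piE; apply/asboolP.
by rewrite piE => /asboolP.
Qed.

Lemma teq_repr x : tensor_eq (repr (\pi_tensor x)) x.
Proof. by apply/teq_pi; rewrite reprK. Qed.

Definition tensor_map (h : T -> T) (x : seq (T * V)) : seq (T * V) :=
  [seq (h tv.1, tv.2) | tv <- x].

Lemma teq_map (h : T -> T) : {morph h : x y / x + y} ->
    (forall c t, h (c *: (t : kmod T)) = c *: (h t : kmod T)) ->
  forall x y, tensor_eq x y -> tensor_eq (tensor_map h x) (tensor_map h y).
Proof.
move=> hD hZ x y; have h0 : h 0 = 0 by apply: (addrI (h 0)); rewrite -hD !addr0.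
elim=> {x y}; rewrite /tensor_map /=.
- by move=> x; apply: teq_refl.
- by move=> x y _; apply: teq_sym.
- by move=> x y z _ IH1 _; apply: teq_trans IH1.
- by move=> x x' y y' _ IH1 _ IH2; rewrite !map_cat; apply: teq_cat.
- by move=> x y; rewrite !map_cat; apply: teq_catC.
- by move=> v; rewrite h0; apply: teq_0.
- by move=> t t' v; rewrite hD; apply: teq_Dl.
- by move=> t v v'; apply: teq_Dr.
- by move=> c t v; rewrite hZ; apply: teq_Z.
Qed.

Definition tens_zero : tensor := \pi_tensor [::].
Definition tens_add (x y : tensor) : tensor := \pi_tensor (repr x ++ repr y).
Definition tens_opp (x : tensor) : tensor :=
  \pi_tensor (tensor_map -%R (repr x)).
Definition tens_scale (a : A) (x : tensor) : tensor :=
  \pi_tensor (tensor_map ( *:%R a) (repr x)).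

Lemma tens_addE x y :
  tens_add (\pi_tensor x) (\pi_tensor y) = \pi_tensor (x ++ y).
Proof. by apply/teq_pi; apply: teq_cat; apply: teq_repr. Qed.

Lemma tens_oppE x : tens_opp (\pi_tensor x) = \pi_tensor (tensor_map -%R x).
Proof.
apply/teq_pi; apply: teq_map (teq_repr x) => [t t'|c t]; first exact: opprD.
by rewrite -scalerN.
Qed.

Lemma tens_scaleE a x :
  tens_scale a (\pi_tensor x) = \pi_tensor (tensor_map ( *:%R a) x).
Proof.
apply/teq_pi; apply: teq_map (teq_repr x) => [t t'|c t]; first exact: scalerDr.
by rewrite -kscale_scaleC.
Qed.

Lemma tens_addA : associative tens_add.
Proof.
elim/quotW=> x; elim/quotW=> y; elim/quotW=> z.
by rewrite (tens_addE y z) (tens_addE x y) (tens_addE x) (tens_addE _ z) catA.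
Qed.

Lemma tens_addC : commutative tens_add.
Proof.
elim/quotW=> x; elim/quotW=> y; rewrite (tens_addE x y) (tens_addE y x).
by apply/teq_pi; apply: teq_catC.
Qed.

Lemma tens_add0 : left_id tens_zero tens_add.
Proof. by elim/quotW=> x; rewrite tens_addE. Qed.

Lemma teq_catCA x y z : tensor_eq (x ++ y ++ z) (y ++ x ++ z).
Proof.
by rewrite !catA; apply: teq_cat (teq_refl _); apply: teq_catC.
Qed.

Lemma tens_addN : left_inverse tens_zero tens_opp tens_add.
Proof.
elim/quotW=> x; rewrite tens_oppE tens_addE; apply/teq_pi.
elim: x => [|[t v] x IH]; first exact: teq_refl.
apply: (@teq_trans _ ([:: (- t, v); (t, v)] ++ (tensor_map -%R x ++ x))).
  apply: (@teq_cat [:: (- t, v)] _ _ _ (teq_refl _)).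
  exact: (teq_catCA (tensor_map -%R x) [:: (t, v)] x).
rewrite -[[::]]/([::] ++ [::] : seq (T * V)); apply: teq_cat => //.
apply: teq_trans (teq_sym (teq_Dl _ _ _)) _.
by rewrite addNr; apply: teq_0.
Qed.

HB.instance Definition _ := GRing.isZmodule.Build tensor
  tens_addA tens_addC tens_add0 tens_addN.

Lemma tens_scaleA a b x : tens_scale a (tens_scale b x) = tens_scale (a * b) x.
Proof.
elim/quotW: x => x; rewrite (tens_scaleE b x) (tens_scaleE a) (tens_scaleE _ x).
rewrite /tensor_map -map_comp.
by apply: (congr1 \pi); apply: eq_map => tv /=; rewrite scalerA.
Qed.

Lemma tens_scale1 : left_id 1 tens_scale.
Proof.
elim/quotW=> x; rewrite tens_scaleE /tensor_map.
apply: (congr1 \pi); rewrite -[RHS]map_id.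
by apply: eq_map => -[t v] /=; rewrite scale1r.
Qed.

Lemma tens_scaleDr : right_distributive tens_scale +%R.
Proof.
move=> a; elim/quotW=> x; elim/quotW=> y.
rewrite [X in tens_scale a X = _]tens_addE (tens_scaleE a x) (tens_scaleE a y).
rewrite (tens_scaleE a).
rewrite [RHS]tens_addE.
by rewrite /tensor_map map_cat.
Qed.

Lemma tens_scaleDl x : {morph tens_scale^~ x : a b / a + b}.
Proof.
elim/quotW: x => x a b /=.
rewrite (tens_scaleE a x) (tens_scaleE b x) (tens_scaleE _ x) [RHS]tens_addE.
apply/teq_pi.
elim: x => [|[t v] x IH]; first exact: teq_refl.
apply: (@teq_trans _ ([:: (a *: t, v); (b *: t, v)] ++
    (tensor_map ( *:%R a) x ++ tensor_map ( *:%R b) x))).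
  by apply: (@teq_cat [:: _]) => //=; rewrite scalerDl; apply: teq_Dl.
apply: (@teq_cat [:: (a *: t, v)] _ _ _ (teq_refl _)).
exact: (teq_catCA [:: (b *: t, v)] (tensor_map _ x) (tensor_map _ x)).
Qed.

(* a . (t (x) v) = (a t) (x) v *)
HB.instance Definition _ := GRing.Zmodule_isLmodule.Build A tensor
  tens_scaleA tens_scale1 tens_scaleDr tens_scaleDl.

Lemma pureDl t t' v : pure (t + t') v = pure t v + pure t' v.
Proof.
rewrite [RHS]tens_addE; apply/teq_pi; exact: teq_Dl.
Qed.

Lemma pureDr t v v' : pure t (v + v') = pure t v + pure t v'.
Proof.
rewrite [RHS]tens_addE; apply/teq_pi; exact: teq_Dr.
Qed.

Lemma pure_kscale (c : k) (t : T) v :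
  pure (c *: (t : kmod T)) v = pure t (c *: v).
Proof. by apply/teq_pi; apply: teq_Z. Qed.

Lemma pure_scale (a : A) t v : pure (a *: t) v = a *: pure t v.
Proof. by rewrite [RHS]tens_scaleE. Qed.

Lemma tensor_sum (x : tensor) : exists s : seq (T * V),
  x = \sum_(tv <- s) pure tv.1 tv.2.
Proof.
elim/quotW: x => s; exists s; elim: s => [|[t v] s IH].
  by rewrite big_nil.
by rewrite big_cons -IH [RHS]tens_addE.
Qed.

End Tensor.

(* The one-point extension A[T] : the triple ((a, t), l) is the matrix
   [a t; 0 l]. *)
Definition opext (k : fieldType) (A : kAlgType k) (T : lmodType A) : Type :=
  (A * T * k)%type.

Section OnePointExtension.
Variables (k : fieldType) (A : kAlgType k) (T : lmodType A).
Local Notation B := (opext T).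

HB.instance Definition _ := GRing.Zmodule.on (opext T).

Definition opmx (a : A) (t : T) (l : k) : B := (a, t, l).

Definition op_mul (x y : B) : B :=
  let: (a, t, l) := x in let: (a', t', l') := y in
  opmx (a * a') (a *: (t' : T) + l' *: (t : kmod T)) (l * l').

Definition op_one : B := opmx 1 0 1.

Lemma op_mulA : associative op_mul.
Proof.
move=> [[a t] l] [[a' t'] l'] [[a'' t''] l'']; congr (_, _, _).
- by rewrite mulrA.
- rewrite /= scalerDr (scalerDr l'' (_ : kmod T)) [a *: (a' *: _)]scalerA addrA.
  rewrite kscale_scaleC (scalerA l'' l' (t : kmod T)).
  by rewrite (mulrC l' l'').
- by rewrite mulrA.
Qed.

Lemma op_mul1l : left_id op_one op_mul.
Proof.
move=> [[a t] l]; congr (_, _, _); rewrite ?mul1r //.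
by rewrite /= scale1r (scaler0 (kmod T)) addr0.
Qed.

Lemma op_mul1r : right_id op_one op_mul.
Proof.
move=> [[a t] l]; congr (_, _, _); rewrite ?mulr1 //.
by rewrite /= scaler0 add0r (scale1r (t : kmod T)).
Qed.

Lemma op_mulDl : left_distributive op_mul +%R.
Proof.
move=> [[a t] l] [[a' t'] l'] [[a'' t''] l'']; congr (_, _, _);
  rewrite ?mulrDl //.
by rewrite /= scalerDl (scalerDr l'' (_ : kmod T)) addrACA.
Qed.

Lemma op_mulDr : right_distributive op_mul +%R.
Proof.
move=> [[a t] l] [[a' t'] l'] [[a'' t''] l'']; congr (_, _, _);
  rewrite ?mulrDr //.
by rewrite /= scalerDr (scalerDl (t : kmod T)) addrACA.
Qed.

HB.instance Definition _ := GRing.Zmodule_isPzRing.Build (opext T)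
  op_mulA op_mul1l op_mul1r op_mulDl op_mulDr.

Definition op_kscal (c : k) : B := opmx (kscal c) 0 c.

Lemma op_kscal1 : op_kscal 1 = 1.
Proof. by rewrite /op_kscal kscal1. Qed.

Lemma op_kscalD : {morph op_kscal : c d / c + d}.
Proof.
by move=> c d; rewrite /op_kscal kscalD; congr (_, _, _); rewrite /= addr0.
Qed.

Lemma op_kscalM : {morph op_kscal : c d / c * d}.
Proof.
move=> c d; rewrite /op_kscal kscalM; congr (_, _, _).
by rewrite /= scaler0 (scaler0 (kmod T)) addr0.
Qed.

Lemma op_kscalC (c : k) (x : B) : op_kscal c * x = x * op_kscal c.
Proof.
move: x => [[a t] l]; congr (_, _, _); first exact: kscalC.
- by rewrite /= (scaler0 (kmod T)) scaler0 add0r addr0.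
- exact: mulrC.
Qed.

HB.instance Definition _ := PzRing_isKAlgebra.Build k (opext T)
  op_kscal1 op_kscalD op_kscalM op_kscalC.

End OnePointExtension.

(* ~R, the span of the idempotents [e_i 0; 0 0] and [0 0; 0 1]. *)
Definition ext_vertex_subalg (k : fieldType) (Q : quiver)
    (T : lmodType (path_alg k Q)) : set (opext T) :=
  [set x | exists (c : vertex Q -> k) (l : k),
    x = \sum_i kscal (c i) * opmx (pa_idem k i) 0 0 + kscal l * opmx 0 0 1].

Arguments ext_vertex_subalg {k Q} T.

(* The left A[T]-module of a triple (M, V, f), on the space M (+) V. *)
Definition triple_mod (k : fieldType) (A : kAlgType k) (T : lmodType A)
  (M : lmodType A) (V : lmodType k) (f : {linear tensor T V -> M}) : Type :=
  (M * V)%type.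

Section TripleModule.
Variables (k : fieldType) (A : kAlgType k) (T M : lmodType A) (V : lmodType k).
Variable f : {linear tensor T V -> M}.

HB.instance Definition _ := GRing.Zmodule.on (triple_mod f).

Definition triple_scale (x : opext T) (u : triple_mod f) : triple_mod f :=
  let: (a, t, l) := x in (a *: u.1 + f (pure (t : T) u.2), l *: u.2).

Lemma triple_scaleA x y u :
  triple_scale x (triple_scale y u) = triple_scale (x * y) u.
Proof.
move: x y u => [[a t] l] [[a' t'] l'] [m v].
congr (_, _); rewrite /= ?scalerA //.
by rewrite pureDl pure_scale pure_kscale linearD linearZ scalerDr scalerA addrA.
Qed.

Lemma triple_scale1 : left_id 1 triple_scale.
Proof.
move=> [m v]; congr (_, _); rewrite /= scale1r //.
by rewrite -(scale0r (0 : T)) pure_scale scale0r linear0 addr0.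
Qed.

Lemma triple_scaleDr : right_distributive triple_scale +%R.
Proof.
move=> [[a t] l] [m v] [m' v']; congr (_, _); rewrite /= ?scalerDr //.
by rewrite pureDr linearD addrACA.
Qed.

Lemma triple_scaleDl u : {morph triple_scale^~ u : x y / x + y}.
Proof.
move: u => [m v] [[a t] l] [[a' t'] l']; congr (_, _); rewrite /= ?scalerDl //.
by rewrite pureDl linearD addrACA.
Qed.

HB.instance Definition _ := GRing.Zmodule_isLmodule.Build (opext T)
  (triple_mod f) triple_scaleA triple_scale1 triple_scaleDr
  triple_scaleDl.

Definition full : Prop := forall m : M, exists x : tensor T V, f x = m.

End TripleModule.

(* Der_S(B, Hom_S(N, M)) : the k-derivations B -> Hom_k(N, M) vanishing on S,
   for the bimodule structure (b phi c)(n) = b phi(c n) on Hom_k(N, M). *)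
Definition Der (k : fieldType) (B : kAlgType k) (S : set B) (N M : lmodType B) :
    set (B -> kmod N -> kmod M) :=
  [set delta : B -> kmod N -> kmod M | [/\
    forall b, linear (delta b),
    forall (c : k) (x y : B), delta (kscal c * x + y) = c *: delta x + delta y,
    forall (b c : B) (n : N),
      delta (b * c) n = b *: (delta c n : M) + delta b (c *: n)
  & forall s, S s -> delta s = 0]].

Arguments Der {k B} S N M.

(* Hom_A(N, M) inside the k-space of all maps N -> M. *)
Definition Hom (k : fieldType) (A : kAlgType k) (N M : lmodType A) :
    set (N -> kmod M) :=
  [set phi : N -> kmod M | linear (phi : N -> M)].

Arguments Hom {k A} N M.

Definition projective (k : fieldType) (A : kAlgType k) (P : lmodType A) :
  Prop :=
  forall (X Y : lmodType A) (g : {linear X -> Y}) (h : {linear P -> Y}),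
    (forall y, exists x, g x = y) ->
    exists h' : {linear P -> X}, forall p, g (h' p) = h p.

Record proj_resolution (k : fieldType) (A : kAlgType k) (T : lmodType A) := {
  pr_obj : nat -> lmodType A;
  pr_diff : forall n, {linear pr_obj n.+1 -> pr_obj n};
  pr_aug : {linear pr_obj 0 -> T};
  pr_proj : forall n, projective (pr_obj n);
  pr_aug_surj : forall t, exists x, pr_aug x = t;
  pr_exact0 : forall x, pr_aug x = 0 <-> exists y, pr_diff 0 y = x;
  pr_exactS : forall n x, pr_diff n x = 0 <-> exists y, pr_diff n.+1 y = x
}.

Section Ext.
Variables (k : fieldType) (A : kAlgType k) (T M : lmodType A).
Variable P : proj_resolution T.

Definition cocycle (n : nat) : set (pr_obj P n -> kmod M) :=
  [set phi | Hom (pr_obj P n) M phi /\ forall x, phi (pr_diff P n x) = 0].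

Definition coboundary (n : nat) : set (pr_obj P n -> kmod M) :=
  match n with
  | 0 => [set 0]
  | n'.+1 => [set phi | exists2 psi : pr_obj P n' -> kmod M,
                Hom (pr_obj P n') M psi &
                forall x, phi x = psi (pr_diff P n' x)]
  end.

End Ext.

Arguments cocycle {k A T} M P n.
Arguments coboundary {k A T} M P n.

(* dim_k Ext^n_A(T, M) = d, with Ext^n_A(T, M) = H^n(Hom_A(P, M)) for a
   projective resolution P of T; the dimension does not depend on P. *)
Definition ext_dim (k : fieldType) (A : kAlgType k) (n : nat) (T M : lmodType A)
    (d : nat) : Prop :=
  exists P : proj_resolution T,
    subquot_dim (cocycle M P n) (coboundary M P n) d.

Definition euler_form (k : fieldType) (A : kAlgType k) (T M : lmodType A)
    (chi : int) : Prop :=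
  exists h e : nat, [/\ has_dim (Hom T M) h, ext_dim 1 T M e &
    chi = h%:Z - e%:Z].

(* Main.v *)
From HB Require Import structures.
Require Import Defs.
From mathcomp Require Import all_boot all_order all_algebra finmap.
From mathcomp.multinomials Require Import monalg.
From mathcomp Require Import boolp classical_sets functions.

Set Implicit Arguments.
Unset Strict Implicit.
Unset Printing Implicit Defensive.

Import GRing.Theory.
Local Open Scope ring_scope.

(** A derivation of A[T] that vanishes on the idempotents is block-shaped: it
    amounts to a derivation d : A -> Hom(N, M) vanishing on R together with a
    family s : T x W -> M, linear in both arguments, such that
      s(a t, w) = a s(t, w) + d(a) (g (t (x) w))
    ([triple_der_Der], [triple_der_surj]).  Forgetting s maps
    Der(A[T], ...) to Der(A, ...), and the kernel, where d = 0, consists of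
    the linear maps W -> Hom_A(T, M), so that it has dimension
    dim W . dim Hom_A(T, M).

    The obstruction to finding s for a given d is, for each w in W, the class
    in Ext^1(T, M) of the derivation a |-> d(a) (g (- (x) w)).  This group is
    zero.  Fullness of (M, V, f) makes M a quotient of a power T^n
    ([full_quotient]); the functor Ext^1(T, -) is right exact because A is
    hereditary, and Ext^1(T, T) = 0.  In terms of derivations: kQ is free over
    its vertices on the arrows, so any arrow data extend to a derivation
    ([arrow_der_Der]) and any derivation into M lifts to one into T^n
    ([Der_lift]); its n components are inner since Ext^1(T, T) = 0, hence the
    derivation into M is inner as well ([quotient_derivation_inner]).
    Thus the forgetful map is onto, <T, M> = dim Hom_A(T, M), and adding
    the dimensions of kernel and image gives the formula
    ([has_dim_triple_Der]).

    The passage between derivations and Ext^1, which is computed from a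
    projective resolution P of T, goes both ways.  A derivation d defines an
    extension of N by M; lifting the augmentation of P to it yields a
    1-cocycle, and a bounding cochain corrects the lift to a map that descends
    to N and exhibits d as inner ([derivation_inner]).  Conversely a 1-cocycle
    phi and a linear section sigma of the augmentation define the derivation
    a |-> phi (a sigma - sigma a); when it is inner, phi is a coboundary
    ([ext1_vanish]). *)

(** * Bases and dimensions of subspaces *)

Definition mklinear (R : pzRingType) (U V : lmodType R) (f : U -> V)
    (fL : linear f) : {linear U -> V} :=
  HB.pack_for {linear U -> V} f (GRing.isLinear.Build _ _ _ _ _ fL).

Section UnbundledLinear.
Variables (R : pzRingType) (U V : lmodType R) (f : U -> V).
Hypothesis fL : linear f.

Lemma linear_fun0 : f 0 = 0.
Proof. exact: (linear0 (mklinear fL)). Qed.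

Lemma linear_funD : {morph f : x y / x + y}.
Proof. exact: (linearD (mklinear fL)). Qed.

Lemma linear_funZ (c : R) x : f (c *: x) = c *: f x.
Proof. exact: (linearZ_LR (mklinear fL)). Qed.

End UnbundledLinear.

Lemma subquot_dim0 (k : fieldType) (L : lmodType k) (Z W : set L) :
  subquot_dim Z W 0 <-> (forall z, Z z -> W z).
Proof.
split=> [[b [_ bW]] z /bW [c []]|ZW]; first by rewrite big_ord0 subr0.
exists (fun=> 0); split=> [[]//|z Zz]; exists 0; split.
  by rewrite big_ord0 subr0; apply: ZW.
by move=> c _; apply/rowP => -[].
Qed.

(** Bases indexed by an arbitrary finite type spare the reindexing by ordinals,
    e.g. for the disjoint union in [has_dim_triple_Der]. *)
Lemma has_dim_basis (k : fieldType) (L : lmodType k) (Z : set L) (I : finType)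
    (b : I -> L) :
    (forall i, Z (b i)) ->
    (forall z, Z z -> exists c : I -> k, z = \sum_i c i *: b i) ->
    (forall c : I -> k, \sum_i c i *: b i = 0 -> forall i, c i = 0) ->
  has_dim Z #|I|.
Proof.
move=> bZ bspan bfree; exists (fun i => b (enum_val i)).
split=> // z /bspan [c zE].
have sumE (F : I -> L) : \sum_(i < #|I|) F (enum_val i) = \sum_i F i.
  by rewrite (reindex (@enum_val I I)) //=; exists enum_rank => i _;
    rewrite ?enum_valK ?enum_rankK.
exists (\row_i c (enum_val i)); split=> [|c'].
  under eq_bigr do rewrite mxE.
  by rewrite (sumE (fun i => c i *: b i)) zE subrr.
move=> /eqP; rewrite subr_eq0 => /eqP zE'.
apply/rowP => i; rewrite mxE; apply/eqP; rewrite -subr_eq0; apply/eqP.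
have := bfree (fun j => c j - c' 0 (enum_rank j)) _ (enum_val i).
rewrite enum_valK; apply.
under eq_bigr do rewrite scalerBl.
rewrite sumrB -zE -(sumE (fun j => c' 0 (enum_rank j) *: b j)).
under [X in _ - X]eq_bigr do rewrite enum_valK.
by rewrite {1}zE' subrr.
Qed.

Lemma has_dim_basisP (k : fieldType) (L : lmodType k) (Z : set L) d :
    Z 0 -> has_dim Z d ->
  exists b : 'I_d -> L, [/\ forall i, Z (b i),
    forall z, Z z -> exists c : 'I_d -> k, z = \sum_i c i *: b i &
    forall c : 'I_d -> k, \sum_i c i *: b i = 0 -> forall i, c i = 0].
Proof.
move=> Z0 [b [bZ bP]]; exists b; split=> // [z /bP [c [/= zE _]]|c c0 i].
  by exists (c 0); apply/eqP; rewrite -subr_eq0; apply/eqP.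
have [r [_ rU]] := bP 0 Z0.
have r0 : r = 0.
  by apply: rU; rewrite /= big1 ?subr0 // => j _; rewrite mxE scale0r.
have := rU (\row_i c i).
rewrite r0 => /(_ _)/rowP/(_ i); rewrite !mxE => <- //=.
by under eq_bigr do rewrite mxE; rewrite c0 subrr.
Qed.

(** A subspace that embeds into a finite-dimensional space is
    finite-dimensional: a family in it whose image is free and of maximal size
    is a basis. *)
Lemma fin_subspace (k : fieldType) (L : lmodType k) (U : vectType k)
    (iota : {linear L -> U}) (Z : set L) :
    Z 0 -> (forall (c : k) x y, Z x -> Z y -> Z (c *: x + y)) ->
    (forall z, Z z -> iota z = 0 -> z = 0) ->
  exists d, has_dim Z d.
Proof.
move=> Z0 ZL iinj.
pose P d := exists b : 'I_d -> L,
  (forall i, Z (b i)) /\ free [tuple iota (b i) | i < d].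
have P0 : exists d, `[< P d >].
  exists 0%N; apply/asboolP; exists (fun=> 0); split => //.
  by rewrite (tuple0 [tuple _ | _ < _]) nil_free.
have Pb d : `[< P d >] -> (d <= \dim (fullv : {vspace U}))%N.
  move=> /asboolP [b [_]]; rewrite /free size_tuple => /eqP <-.
  by apply: dimvS; apply: subvf.
have [d /asboolP [b [bZ bfree]] dmax] := ex_maxnP P0 Pb.
exists d; rewrite -[d]card_ord; apply: (@has_dim_basis _ _ _ _ b) => //.
- move=> z Zz.
  (* otherwise z would extend the maximal free family *)
  have ninf : iota z \in <<[tuple iota (b i) | i < d]>>%VS.
    apply: contraT => nz; suff /dmax : `[< P d.+1 >] by rewrite ltnn.
    apply/asboolP; exists (fun i => oapp b z (unlift ord0 i)); split.
      by move=> i; case: unliftP => [j|] _ /=.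
    rewrite (_ : tval _ = iota z :: [tuple iota (b i) | i < d]).
      by rewrite free_cons nz.
    rewrite /= enum_ordSl /= unlift_none /=; congr cons.
    rewrite -map_comp; apply: eq_map => i /=.
    by rewrite liftK.
  exists (fun i => coord [tuple iota (b i) | i < d] i (iota z)).
  apply/eqP; rewrite -subr_eq0; apply/eqP; apply: iinj.
    rewrite addrC -scaleN1r.
    have ZS :
        Z (\sum_(i < d) coord [tuple iota (b i) | i < d] i (iota z) *: b i).
      by elim/big_ind: _ => // [x y Zx Zy|i _];
        [rewrite -[x]scale1r; apply: ZL | rewrite -[_ *: _]addr0; apply: ZL].
    exact: ZL.
  rewrite linearB linear_sum /= {1}(coord_span ninf); apply/eqP.
  rewrite subr_eq0; apply/eqP; apply: eq_bigr => i _.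
  by rewrite linearZ -tnth_nth tnth_map tnth_ord_tuple.
- move=> c c0 i; move/freeP: bfree; apply.
  transitivity (iota (\sum_i c i *: b i)); last by rewrite c0 linear0.
  rewrite linear_sum; apply: eq_bigr => j _.
  by rewrite linearZ -tnth_nth tnth_map tnth_ord_tuple.
Qed.

Lemma has_dim_coord (k : fieldType) (L : lmodType k) d :
    has_dim [set: L] d ->
  exists (b : 'I_d -> L) (co : {linear L -> 'rV[k]_d}),
    forall x, x = \sum_i co x 0 i *: b i.
Proof.
move=> /(has_dim_basisP (Z := setT) I) [b [_ bspan bfree]].
have {bspan} [co coE] := choice (fun x => bspan x I).
have coL : linear (fun x => \row_i co x i).
  move=> c x y; apply/rowP => i; rewrite !mxE; apply/eqP; rewrite -subr_eq0.
  apply/eqP; move: i; apply: bfree.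
  under eq_bigr do rewrite scalerBl scalerDl -scalerA.
  by rewrite sumrB big_split /= -scaler_sumr -!coE subrr.
exists b, (mklinear coL) => x /=.
by rewrite {1}[x]coE; apply: eq_bigr => i _; rewrite mxE.
Qed.

(** A linear relation that is total on a finite-dimensional space contains the
    graph of a linear map: choose images of the basis vectors. *)
Lemma linear_selection (k : fieldType) (L L' : lmodType k) d
    (rel : L -> L' -> Prop) :
    has_dim [set: L] d -> rel 0 0 ->
    (forall (c : k) x y x' y', rel x x' -> rel y y' ->
      rel (c *: x + y) (c *: x' + y')) ->
    (forall x, exists x', rel x x') ->
  exists2 h : L -> L', linear h & forall x, rel x (h x).
Proof.
move=> /has_dim_coord [b [co coE]] rel0 relL rel_total.
have [b' b'P] := choice (fun i => rel_total (b i)).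
exists (fun x => \sum_i co x 0 i *: b' i) => [c x y|x].
  rewrite scaler_sumr -big_split; apply: eq_bigr => i _.
  by rewrite linearP !mxE scalerDl scalerA.
rewrite {1}[x]coE; elim/big_ind2: _ => // [u u' v v' uu' vv'|i _].
  by rewrite -[u]scale1r -[u']scale1r; apply: relL.
by rewrite -[X in rel X _]addr0 -[X in rel _ X]addr0; apply: relL.
Qed.

Lemma has_dim_vectType (k : fieldType) (W : vectType k) :
  has_dim [set: W] (\dim (fullv : {vspace W})).
Proof.
rewrite -[\dim _]card_ord.
apply: (@has_dim_basis _ _ _ _ (tnth (vbasis {:W}))) => //.
  move=> x _; exists (fun i => coord (vbasis {:W}) i x).
  rewrite {1}(coord_vbasis (memvf x)).
  by apply: eq_bigr => i _; rewrite -tnth_nth.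
move=> c c0 i; move/freeP: (basis_free (vbasisP {:W})); apply.
by rewrite -[RHS]c0; apply: eq_bigr => j _; rewrite -tnth_nth.
Qed.

(** * Derivations *)

Section RestrictScalars.
Variables (k : fieldType) (A : kAlgType k).

Lemma linear_kmod (N M : lmodType A) (h : N -> M) :
  linear h -> linear (h : kmod N -> kmod M).
Proof. by move=> hL c x y; rewrite [LHS]hL. Qed.

Lemma kscaleZ (X : lmodType A) (a : A) (c : k) (x : X) :
  a *: (c *: (x : kmod X) : X) = c *: (a *: x : kmod X).
Proof. by rewrite -kscale_scaleC. Qed.

End RestrictScalars.

Section DerTheory.
Variables (k : fieldType) (A : kAlgType k) (S : set A) (N M : lmodType A).
Variable d : A -> kmod N -> kmod M.
Hypothesis dD : Der S N M d.

Lemma der_linear a : linear (d a). Proof. by case: dD. Qed.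

Lemma derDr a : {morph d a : x y / x + y}.
Proof. exact: (linear_funD (der_linear a)). Qed.

Lemma der0r a : d a 0 = 0.
Proof. exact: (linear_fun0 (der_linear a)). Qed.

Lemma derZr a (c : k) x : d a (c *: x) = c *: d a x.
Proof. exact: (linear_funZ (der_linear a)). Qed.

Lemma der_lin a b (c : k) x : d (kscal c * a + b) x = c *: d a x + d b x.
Proof. by case: dD => _ -> _ _. Qed.

Lemma derDl a b x : d (a + b) x = d a x + d b x.
Proof. by rewrite -[a]mul1r -kscal1 der_lin scale1r kscal1 mul1r. Qed.

Lemma der0l x : d 0 x = 0.
Proof. by apply: (addrI (d 0 x)); rewrite -derDl !addr0. Qed.

Lemma derZl a (c : k) x : d (kscal c * a) x = c *: d a x.
Proof. by rewrite -[_ * a]addr0 der_lin der0l addr0. Qed.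

Lemma derM a b (x : N) : d (a * b) x = a *: (d b x : M) + d a (b *: x).
Proof. by case: dD => _ _ ->. Qed.

Lemma der_vanish a x : S a -> d a x = 0.
Proof. by case: dD => _ _ _ /[apply] ->. Qed.

Lemma der1 x : d 1 x = 0.
Proof.
apply: (addrI (d 1 x)); rewrite addr0 -{3}[1](mulr1 1) derM.
by rewrite [in RHS]scale1r [in X in _ = _ + X]scale1r.
Qed.

End DerTheory.

Section DerSpace.
Variables (k : fieldType) (A : kAlgType k) (S : set A) (N M : lmodType A).

Lemma Der0 : Der S N M 0.
Proof.
by split=> [a c x y|c x y|b c n|//]; rewrite ?scaler0 ?addr0.
Qed.

Lemma Der_linear_comb (c : k) d d' :
  Der S N M d -> Der S N M d' -> Der S N M (c *: d + d').
Proof.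
move=> dD d'D; split=> [a b x y|b x y|a b n|s Ss].
- rewrite -[(c *: d + d') a]/(c *: d a + d' a).
  rewrite -![(_ *: d a + _) _]/(c *: d a _ + d' a _).
  rewrite (der_linear dD) (der_linear d'D) !scalerDr !scalerA.
  by rewrite [c * b]mulrC addrACA.
- apply/funext => n.
  rewrite -[LHS]/(c *: d _ n + d' _ n).
  rewrite -[RHS]/(b *: (c *: d x n + d' x n) + (c *: d y n + d' y n)).
  rewrite (der_lin dD) (der_lin d'D) !scalerDr !scalerA.
  by rewrite [c * b]mulrC addrACA.
- rewrite -[LHS]/(c *: d _ n + d' _ n).
  rewrite -[RHS]/(a *: (c *: d b n + d' b n : M) +
    (c *: d a (b *: n) + d' a (b *: n))).
  rewrite (derM dD) (derM d'D) !scalerDr addrACA; congr (_ + _ + _).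
  exact: kscale_scaleC.
- apply/funext => n; rewrite -[LHS]/(c *: d s n + d' s n).
  by rewrite (der_vanish dD) // (der_vanish d'D) // scaler0 addr0.
Qed.

Lemma Der_comp (N' : lmodType A) (gam : {linear N' -> N}) d :
  Der S N M d -> Der S N' M (fun a x => d a (gam x)).
Proof.
move=> dD; split=> [a c x y|c x y|b c n|s Ss].
- by rewrite linearP (der_linear dD).
- by apply/funext => n; rewrite (der_lin dD).
- by rewrite (derM dD) linearZ.
- by apply/funext => n; rewrite (der_vanish dD).
Qed.

Lemma Der_post (M' : lmodType A) (pi : {linear M -> M'}) d :
  Der S N M d -> Der S N M' (fun a x => pi (d a x)).
Proof.
move=> dD; split=> [a c x y|c x y|b c n|s Ss].
- by rewrite (der_linear dD) linearP.
- by apply/funext => n; rewrite (der_lin dD) linearP.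
- by rewrite (derM dD) linearP.
- by apply/funext => n; rewrite (der_vanish dD) // linear0.
Qed.

End DerSpace.

(** * Inner derivations and the first extension group *)

(** The class of d in Ext^1_A(N, M) vanishes exactly when d is inner. *)
Definition inner_der (k : fieldType) (A : kAlgType k) (N M : lmodType A)
    (d : A -> kmod N -> kmod M) : Prop :=
  exists2 h : kmod N -> kmod M, linear h &
    forall a (x : N), d a x = h (a *: x) - a *: (h x : M).

(** The extension of N by M with class d: the space M (+) N on which a acts by
    a (m, n) = (a m + d(a) n, a n). *)
Definition ext_mod (k : fieldType) (A : kAlgType k) (S : set A)
    (N M : lmodType A) (d : A -> kmod N -> kmod M) (dD : Der S N M d) : Type :=
  (M * N)%type.

Section ExtMod.
Variables (k : fieldType) (A : kAlgType k) (S : set A) (N M : lmodType A).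
Variables (d : A -> kmod N -> kmod M) (dD : Der S N M d).
Local Notation E := (ext_mod dD).

HB.instance Definition _ := GRing.Zmodule.on E.

Definition ext_scale (a : A) (x : E) : E := (a *: x.1 + d a x.2, a *: x.2).

Lemma ext_scaleA a b x : ext_scale a (ext_scale b x) = ext_scale (a * b) x.
Proof.
congr (_, _); rewrite /= ?scalerA // (derM dD) scalerDr scalerA.
by rewrite addrA.
Qed.

Lemma ext_scale1 : left_id 1 ext_scale.
Proof.
by case=> m n; congr (_, _); rewrite /= scale1r // (der1 dD) addr0.
Qed.

Lemma ext_scaleDr : right_distributive ext_scale +%R.
Proof.
move=> a x y; congr (_, _); rewrite /= ?scalerDr //.
by rewrite (derDr dD) addrACA.
Qed.

Lemma ext_scaleDl x : {morph ext_scale^~ x : a b / a + b}.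
Proof.
move=> a b; congr (_, _); rewrite /= ?scalerDl //.
by rewrite (derDl dD) addrACA.
Qed.

HB.instance Definition _ := GRing.Zmodule_isLmodule.Build A E
  ext_scaleA ext_scale1 ext_scaleDr ext_scaleDl.

Definition ext_proj (x : E) : N := x.2.
Lemma ext_proj_linear : linear ext_proj. Proof. by []. Qed.

End ExtMod.

Lemma subr_swap (V : zmodType) (a b c e : V) : a - c = b - e -> a - b = c - e.
Proof.
move/eqP; rewrite subr_eq => /eqP ->.
by rewrite addrAC (addrAC b) subrr add0r addrC.
Qed.

(** Lift the augmentation P_0 -> N to a map (u, aug) into the extension defined
    by d.  The first component is linear up to d, and on the image of P_1 it is
    a cocycle, say the restriction of psi; then u - psi vanishes on the kernel
    of the augmentation and induces the map h on N. *)
Lemma derivation_inner (k : fieldType) (A : kAlgType k) (S : set A)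
    (N M : lmodType A) (d : A -> kmod N -> kmod M) :
  ext_dim 1 N M 0 -> Der S N M d -> inner_der d.
Proof.
move=> [P /subquot_dim0 ext0] dD.
have [|u uP] := @pr_proj _ _ _ P 0 _ _
  (mklinear (@ext_proj_linear _ _ _ _ _ _ dD)) (pr_aug P).
  by move=> n; exists ((0, n) : ext_mod dD).
have uS p : (u p).2 = pr_aug P p by rewrite -[RHS]uP.
have uL a p q : (u (a *: p + q)).1 = a *: (u p).1 + d a (pr_aug P p) + (u q).1.
  by rewrite linearP /= uS.
have aug_diff y : pr_aug P (pr_diff P 0 y) = 0.
  by apply/pr_exact0; exists y.
have [|psi psiL psiP] := ext0 (fun y => (u (pr_diff P 0 y)).1).
  split=> [a x y|x]; first by rewrite linearP uL aug_diff (der0r dD) addr0.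
  have -> : pr_diff P 0 (pr_diff P 1 x) = 0 by apply/pr_exactS; exists x.
  by rewrite linear0.
have ker_eq p : pr_aug P p = 0 -> (u p).1 = psi p.
  by move=> /pr_exact0 [y <-].
have psi_lin := psiL : linear (psi : _ -> M).
have psiB p q : psi (p - q) = psi p - psi q.
  exact: (raddfB (mklinear psi_lin)).
have hwd p q : pr_aug P p = pr_aug P q -> (u p).1 - psi p = (u q).1 - psi q.
  move=> pq; apply: subr_swap.
  rewrite -psiB -ker_eq; first by rewrite (linearB u).
  by rewrite linearB pq subrr.
have [pre preP] := choice (@pr_aug_surj _ _ _ P).
pose h (x : N) : M := (u (pre x)).1 - psi (pre x).
have hE p : h (pr_aug P p) = (u p).1 - psi p by apply: hwd; rewrite preP.
have hL a x y : h (a *: x + y) = a *: h x + d a x + h y.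
  rewrite -[x]preP -[y]preP -linearP !hE uL psi_lin scalerBr opprD.
  by rewrite addrACA (addrAC _ (d _ _)).
have psi0 : psi 0 = 0 by rewrite -(subrr 0) psiB subrr.
have h0 : h 0 = 0.
  by rewrite -(linear0 (pr_aug P)) hE psi0 linear0 subrr.
have hZ a x : h (a *: x) = a *: h x + d a x.
  by rewrite -[_ *: x]addr0 hL h0 addr0.
exists h => [c x y|a x]; last by rewrite hZ addrC addKr.
rewrite hL -[kscal c]mulr1 (derZl dD) (der1 dD) scaler0 addr0.
by rewrite mulr1.
Qed.

(** The map bar, phi read on the image of P_1, is applied to the failure of
    sigma to be A-linear; this is a derivation, vanishing on S by the
    S-linearity of sigma.  If it is inner by h, then
    p |-> bar (p - sigma (aug p)) - h (aug p) is an A-linear cochain with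
    coboundary phi. *)
Lemma ext1_vanish (k : fieldType) (A : kAlgType k) (S : set A)
    (T M : lmodType A) (P : proj_resolution T)
    (sigma : kmod T -> kmod (pr_obj P 0)) :
    linear sigma -> (forall x, pr_aug P (sigma x) = x) ->
    (forall s (x : T), S s -> sigma (s *: x) = s *: (sigma x : pr_obj P 0)) ->
    (forall d, Der S T M d -> inner_der d) ->
  ext_dim 1 T M 0.
Proof.
move=> sL sK sS inner; exists P; apply/subquot_dim0 => phi [phiL phi0].
have phi_lin := phiL : linear (phi : _ -> M).
have [pre preP] : exists pre : pr_obj P 0 -> pr_obj P 1,
    forall z, pr_aug P z = 0 -> pr_diff P 0 (pre z) = z.
  have /choice [pre preP] :
      forall z, exists y, pr_aug P z = 0 -> pr_diff P 0 y = z.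
    move=> z; have [/pr_exact0[y yz]|nz] := pselect (pr_aug P z = 0).
      by exists y.
    by exists 0.
  by exists pre.
pose bar z : M := phi (pre z).
have barE y : bar (pr_diff P 0 y) = phi y.
  apply/eqP; rewrite -subr_eq0 /bar; apply/eqP.
  rewrite -(raddfB (mklinear phi_lin)) /=.
  have /pr_exactS [w <-] : pr_diff P 0 (pre (pr_diff P 0 y) - y) = 0.
    by rewrite linearB preP ?subrr //; apply/pr_exact0; exists y.
  exact: phi0.
have barL a z z' : pr_aug P z = 0 -> pr_aug P z' = 0 ->
    bar (a *: z + z') = a *: bar z + bar z'.
  by move=> /pr_exact0[y <-] /pr_exact0[y' <-]; rewrite -linearP !barE phi_lin.
have bar0 : bar 0 = 0.
  by rewrite -(linear0 (pr_diff P 0)) barE -(linear0 (pr_diff P 1)) phi0.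
have barD z z' : pr_aug P z = 0 -> pr_aug P z' = 0 ->
    bar (z + z') = bar z + bar z'.
  by move=> *; rewrite -[z in LHS]scale1r barL // scale1r.
have barZ a z : pr_aug P z = 0 -> bar (a *: z) = a *: bar z.
  by move=> z0; rewrite -[_ *: z]addr0 barL ?linear0 // bar0 addr0.
have sD := linear_funD sL; have s0 := linear_fun0 sL.
pose defect (a : A) (x : T) : pr_obj P 0 :=
  a *: (sigma x : pr_obj P 0) - sigma (a *: x).
have defK a x : pr_aug P (defect a x) = 0.
  by rewrite linearB linearZ /= !sK subrr.
pose d (a : A) (x : kmod T) : kmod M := bar (defect a x).
have dD : Der S T M d.
  split=> [a c x y|c a b|a b x|s Ss].
  - rewrite /d [X in _ = X + _]kscaleE -barZ // -barD //; last first.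
      by rewrite linearZ /= defK scaler0.
    congr bar; rewrite /defect sL.
    rewrite (_ : a *: (c *: x + y) =
        c *: (a *: x : kmod T) + (a *: y : kmod T)).
      rewrite sL scalerDr scalerBr opprD addrACA; congr (_ - _ + _).
      by rewrite [LHS]scalerA [RHS]scalerA kscalC.
    rewrite scalerDr; congr (_ + _).
    by rewrite [LHS]scalerA [RHS]scalerA kscalC.
  - apply/funext => x; rewrite /= /d [X in _ = X + _]kscaleE.
    rewrite -barZ // -[RHS]barD //; last by rewrite linearZ /= defK scaler0.
    congr bar; rewrite /defect !scalerDl scalerBr -scalerA.
    rewrite (_ : sigma (_ + _) = c *: sigma (a *: x) + sigma (b *: x)).
      by rewrite opprD addrACA.
    by rewrite -sL; congr (sigma (_ + _)); rewrite -scalerA.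
  - rewrite -[RHS](barL a _ _ (defK b x) (defK a (b *: x))).
    by congr bar; rewrite /defect -!scalerA scalerBr addrA subrK.
  - by apply/funext => x; rewrite /d /defect sS // subrr bar0.
have [h hL hE] := inner d dD.
have hE' a x : bar (defect a x) = (h (a *: x) : M) - a *: (h x : M).
  exact: hE.
have hD (x y : T) : h (x + y) = (h x : M) + (h y : M).
  exact: (linear_funD hL).
have h0 := linear_fun0 hL.
pose r p := p - (sigma (pr_aug P p) : pr_obj P 0).
have rK p : pr_aug P (r p) = 0 by rewrite linearB /= sK subrr.
have rL a p q : r (a *: p + q) = a *: r p + defect a (pr_aug P p) + r q.
  rewrite /r linearP sD /= opprD addrACA; congr (_ + _).
  by rewrite scalerBr /defect addrA subrK.
have augL a p q : pr_aug P (a *: p + q) = a *: pr_aug P p + pr_aug P q.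
  exact: linearP.
have arK a p : pr_aug P (a *: r p) = 0 by rewrite linearZ /= rK scaler0.
exists (fun p => bar (r p) - h (pr_aug P p)) => [a p q|y].
  rewrite rL augL hD (barD (_ + defect _ _)) //; last first.
    by rewrite linearD arK defK addr0.
  rewrite (barD _ (defect _ _)) // barZ // hE' scalerBr opprD [LHS]addrACA.
  by congr (_ + _); rewrite addrA addrAC addrK.
have yK : pr_aug P (pr_diff P 0 y) = 0 by apply/pr_exact0; exists y.
by rewrite /r yK s0 h0 !subr0 barE.
Qed.

(** * Arrows and words in the path algebra *)

Section PathAlgebra.
Variables (k : fieldType) (Q : quiver).
Local Notation A := (path_alg k Q).
Local Notation e := (@pa_idem k Q).

Fact is_walk_arrow (a : arrow Q) : is_walk (src a) [:: a].
Proof. by rewrite /= eqxx. Qed.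

Definition pa_arrow (a : arrow Q) : A :=
  pa_path k (QPath (qpath_val := (src a, [:: a])) (is_walk_arrow a)).

Lemma pa_pathM p q : pa_path k p * pa_path k q = pa_pmul k p q :> A.
Proof. exact: pa_mul_path. Qed.

Lemma idem_pathM i p :
  e i * pa_path k p = if ptgt p == i then pa_path k p else 0.
Proof. by rewrite pa_pathM /pa_pmul pcomp_trivl; case: eqP. Qed.

Lemma path_idemM i p :
  pa_path k p * e i = if psrc p == i then pa_path k p else 0.
Proof. by rewrite pa_pathM /pa_pmul pcomp_trivr; case: eqP. Qed.

Lemma idem_arrowM a : e (tgt a) * pa_arrow a = pa_arrow a.
Proof. by rewrite idem_pathM /ptgt /walk_end /= eqxx. Qed.

Lemma arrow_idemM a : pa_arrow a * e (src a) = pa_arrow a.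
Proof. by rewrite path_idemM /psrc /= eqxx. Qed.

Lemma sum_idem : \sum_i e i = 1. Proof. by []. Qed.

Lemma idem_idemM i j : e i * e j = if i == j then e i else 0.
Proof. by rewrite path_idemM. Qed.

Lemma idem_vertexM (c : vertex Q -> k) i :
  e i * (\sum_j c j *: e j) = c i *: e i.
Proof.
rewrite mulr_sumr (bigD1 i) //= big1 ?addr0.
  by rewrite -[LHS]pa_scaleAr [pa_mul _ _]idem_idemM eqxx.
move=> j /negbTE ji; rewrite -[LHS]pa_scaleAr [pa_mul _ _]idem_idemM eq_sym ji.
by rewrite scaler0.
Qed.

Lemma vertex_idemM (c : vertex Q -> k) i :
  (\sum_j c j *: e j) * e i = c i *: e i.
Proof.
rewrite mulr_suml (bigD1 i) //= big1 ?addr0.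
  by rewrite -[LHS]pa_scaleAl [pa_mul _ _]idem_idemM eqxx.
move=> j /negbTE ji; rewrite -[LHS]pa_scaleAl [pa_mul _ _]idem_idemM ji.
by rewrite scaler0.
Qed.

Lemma idem_vertex i : vertex_subalg k Q (e i).
Proof.
exists (fun j => (j == i)%:R).
rewrite (bigD1 i) //= eqxx scale1r big1 ?addr0 // => j /negbTE ->.
by rewrite scale0r.
Qed.

Lemma scale_actE (X : lmodType A) (c : k) (f : A) (x : X) :
  (c *: f) *: x = c *: (f *: x : kmod X).
Proof. by rewrite kscaleE scalerA pa_kscalE. Qed.

(** The product of the arrows of a word, which need not be a walk: it lets
    inductions on paths run over plain lists, with the walk condition brought
    back by an idempotent as in [pa_path_word]. *)
Fixpoint pa_word (l : seq (arrow Q)) : A :=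
  if l is a :: l' then pa_word l' * pa_arrow a else 1.

Lemma pa_word_cat (l1 l2 : seq (arrow Q)) :
  pa_word (l1 ++ l2) = pa_word l2 * pa_word l1.
Proof. by elim: l1 => [|a l1 IH] /=; rewrite ?mulr1 // IH mulrA. Qed.

Lemma pa_path_word p : pa_path k p = pa_word (qpath_val p).2 * e (psrc p).
Proof.
case: p => -[i l]; rewrite /psrc /=; elim: l i => [|a l IH] i w /=.
  by rewrite mul1r /pa_idem; congr pa_path; apply: val_inj.
have /andP[/eqP ai w'] : is_walk i (a :: l) by [].
have ae : pa_arrow a * e i = pa_arrow a by rewrite -ai arrow_idemM.
rewrite -mulrA ae -[pa_arrow a in RHS]idem_arrowM mulrA -(IH _ w').
rewrite pa_pathM /pa_pmul.
have := pcompP (QPath (qpath_val := (tgt a, l)) w')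
  (QPath (qpath_val := (src a, [:: a])) (is_walk_arrow a)).
rewrite {1}/ptgt /walk_end /= {1}/psrc /= eqxx => -[r -> rE] /=.
by congr pa_path; apply: val_inj; rewrite [RHS]rE /psrc /= ai.
Qed.

Lemma pa_ind_arrow (S : A -> Prop) :
    S 0 -> (forall f g, S f -> S g -> S (f + g)) ->
    (forall c f, S f -> S (c *: f)) -> (forall i, S (e i)) ->
    (forall f a, S f -> S (f * pa_arrow a)) ->
  forall f, S f.
Proof.
move=> S0 SD SZ Se Sa; elim/pa_ind => // p.
rewrite pa_path_word; case: p => -[i l]; rewrite /psrc /=.
elim: l i => [|a l IH] i w; first by rewrite mul1r.
have /andP[/eqP ai w'] : is_walk i (a :: l) by [].
have ae : pa_arrow a * e i = pa_arrow a by rewrite -ai arrow_idemM.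
rewrite /= -mulrA ae -[pa_arrow a]idem_arrowM mulrA; apply: Sa; exact: IH.
Qed.

Section Lift.
Variables (L : lmodType k) (F : qpath Q -> L).

Definition pa_lift (f : A) : L := \sum_(p <- msupp f) f@_p *: F p.

Lemma pa_liftw (dom : {fset qpath Q}) (f : A) : (msupp f `<=` dom)%fset ->
  pa_lift f = \sum_(p <- dom) f@_p *: F p.
Proof.
move=> fdom; apply: big_fset_incl => // p _ /mcoeff_outdom ->.
by rewrite scale0r.
Qed.

Lemma pa_liftP (c : k) f g : pa_lift (c *: f + g) = c *: pa_lift f + pa_lift g.
Proof.
pose dom := (msupp f `|` msupp g)%fset.
have fdom : (msupp f `<=` dom)%fset by apply: fsubsetUl.
have gdom : (msupp g `<=` dom)%fset by apply: fsubsetUr.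
have cfdom : (msupp (c *: f) `<=` dom)%fset.
  exact: fsubset_trans (pa_msuppZ_le _ _) fdom.
rewrite (pa_liftw fdom) (pa_liftw gdom) (@pa_liftw dom); last first.
  apply: fsubset_trans (msuppD_le _ _) _.
  by rewrite fsubUset cfdom.
rewrite scaler_sumr -big_split; apply: eq_bigr => p _ /=.
by rewrite mcoeffD pa_mcoeffZ scalerDl scalerA.
Qed.

Lemma pa_lift_path p : pa_lift (pa_path k p) = F p.
Proof.
rewrite (@pa_liftw [fset p]%fset) ?big_seq_fset1 pa_path.unlock.
  by rewrite mcoeffUU scale1r.
exact: msuppU_le.
Qed.
End Lift.

End PathAlgebra.

(** * Derivations of the path algebra from arrows *)

Section ArrowDer.
Variables (k : fieldType) (Q : quiver).
Local Notation A := (path_alg k Q).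
Local Notation e := (@pa_idem k Q).
Variables (N M : lmodType A) (theta : arrow Q -> kmod N -> kmod M).
Hypothesis thetaL : forall a, linear (theta a).
Hypothesis theta_tgt : forall a (x : N),
  e (tgt a) *: (theta a x : M) = theta a x.
Hypothesis theta_src : forall a (x : N), theta a (e (src a) *: x) = theta a x.

(** By the Leibniz rule a derivation takes the value
    a_m .. a_2 theta(a_1) + .. + theta(a_m) a_(m-1) .. a_1 on a_m .. a_1. *)
Fixpoint word_der (l : seq (arrow Q)) (x : kmod N) : kmod M :=
  if l is a :: l' then
    pa_word k l' *: (theta a x : M) + word_der l' (pa_arrow k a *: (x : N))
  else 0.

Lemma word_der_linear l : linear (word_der l).
Proof.
elim: l => [|a l IH] c x y /=; first by rewrite scaler0 addr0.
rewrite thetaL scalerDr kscaleZ [pa_arrow _ _ *: _]scalerDr kscaleZ IH.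
by rewrite scalerDr addrACA.
Qed.

Lemma word_der0 l : word_der l 0 = 0.
Proof. exact: (linear_fun0 (word_der_linear l)). Qed.

Lemma word_der_cat l1 l2 (x : N) :
  word_der (l1 ++ l2) x =
  pa_word k l2 *: (word_der l1 x : M) + word_der l2 (pa_word k l1 *: x).
Proof.
elim: l1 x => [|a l1 IH] x /=; first by rewrite scaler0 add0r scale1r.
by rewrite IH pa_word_cat scalerDr !scalerA addrA.
Qed.

Definition arrow_der : A -> kmod N -> kmod M :=
  pa_lift (fun p x => word_der (qpath_val p).2 (e (psrc p) *: (x : N))).

Lemma arrow_der_path p x : arrow_der (pa_path k p) x =
  word_der (qpath_val p).2 (e (psrc p) *: (x : N)).
Proof. by rewrite /arrow_der pa_lift_path. Qed.

Lemma arrow_derP (c : k) f g x :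
  arrow_der (c *: f + g) x = c *: arrow_der f x + arrow_der g x.
Proof. by rewrite /arrow_der pa_liftP. Qed.

Lemma arrow_der0 x : arrow_der 0 x = 0.
Proof.
have := arrow_derP (-1) 0 0 x.
by rewrite scaler0 addr0 scaleN1r addNr.
Qed.

Lemma arrow_derD f g x : arrow_der (f + g) x = arrow_der f x + arrow_der g x.
Proof. by rewrite -[f in LHS]scale1r arrow_derP scale1r. Qed.

Lemma arrow_derZ (c : k) f x : arrow_der (c *: f) x = c *: arrow_der f x.
Proof. by rewrite -[_ *: f]addr0 arrow_derP arrow_der0 addr0. Qed.

Lemma arrow_der_linear f : linear (arrow_der f).
Proof.
move=> c x y; elim/pa_ind: f => [|f g IH1 IH2|b f IH|p].
- by rewrite !arrow_der0 scaler0 addr0.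
- by rewrite !arrow_derD IH1 IH2 scalerDr addrACA.
- by rewrite !arrow_derZ IH scalerDr !scalerA mulrC.
- by rewrite !arrow_der_path scalerDr kscaleZ word_der_linear.
Qed.

Lemma arrow_derDr f x y : arrow_der f (x + y) = arrow_der f x + arrow_der f y.
Proof. exact: (linear_funD (arrow_der_linear f)). Qed.

Lemma arrow_der0r f : arrow_der f 0 = 0.
Proof. exact: (linear_fun0 (arrow_der_linear f)). Qed.

Lemma arrow_derZr f (c : k) x : arrow_der f (c *: x) = c *: arrow_der f x.
Proof. exact: (linear_funZ (arrow_der_linear f)). Qed.

Lemma word_der_tgt i l (x : N) : is_walk i l ->
  e (walk_end i l) *: (word_der l (e i *: x) : M) = word_der l (e i *: x).
Proof.
elim: l i x => [|a l IH] i x /=; first by rewrite scaler0.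
case/andP=> /eqP ai w; rewrite scalerDr.
have -> : pa_arrow k a *: (e i *: x) = e (tgt a) *: (pa_arrow k a *: x).
  by rewrite -ai !scalerA arrow_idemM idem_arrowM.
rewrite IH //; congr (_ + _).
rewrite -theta_tgt !scalerA -mulrA.
have := pa_path_word k (QPath (qpath_val := (tgt a, l)) w).
rewrite /psrc /= => <-.
by rewrite idem_pathM /ptgt eqxx.
Qed.

(** If p and q do not compose, each term on the right vanishes because the
    idempotents at the end of q and at the start of p are orthogonal. *)
Lemma arrow_der_pathM p q (x : N) :
  arrow_der (pa_path k p * pa_path k q) x =
  pa_path k p *: (arrow_der (pa_path k q) x : M) +
  arrow_der (pa_path k p) (pa_path k q *: x).
Proof.
have wq : is_walk (psrc q) (qpath_val q).2 by apply: valP q.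
rewrite !arrow_der_path.
rewrite -(word_der_tgt _ wq) -/(ptgt q) !scalerA path_idemM idem_pathM eq_sym.
rewrite pa_pathM /pa_pmul; have := pcompP p q.
case: eqP => [pq [r -> rE]|_ ->] /=; last first.
  by rewrite arrow_der0 !scale0r word_der0 addr0.
rewrite arrow_der_path rE word_der_cat pa_path_word.
have -> : psrc r = psrc q by rewrite {1}/psrc rE.
rewrite -scalerA -pq -/(ptgt q) word_der_tgt //.
by rewrite [X in _ + word_der _ X]scalerA -pa_path_word.
Qed.

Lemma arrow_derM f g (x : N) :
  arrow_der (f * g) x = f *: (arrow_der g x : M) + arrow_der f (g *: x).
Proof.
elim/pa_ind: f x => [|f f' IH IH'|c f IH|p] x.
- by rewrite mul0r !arrow_der0 scale0r addr0.
- by rewrite mulrDl !arrow_derD IH IH' scalerDl addrACA.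
- rewrite -[_ * g]pa_scaleAl !arrow_derZ IH scalerDr.
  by rewrite [in X in _ = X + _]scale_actE.
elim/pa_ind: g x => [|g g' IH IH'|c g IH|q] x.
- by rewrite mulr0 !arrow_der0 scale0r scaler0 arrow_der0r addr0.
- by rewrite mulrDr !arrow_derD IH IH' scalerDr scalerDl arrow_derDr addrACA.
- rewrite -[_ * _]pa_scaleAr !arrow_derZ IH scalerDr.
  by rewrite kscaleZ scale_actE arrow_derZr.
- exact: arrow_der_pathM.
Qed.

(** The path algebra is free on its arrows: arrow data compatible with the
    vertices extend to a derivation. *)
Lemma arrow_der_Der : Der (vertex_subalg k Q) N M arrow_der.
Proof.
split.
- exact: arrow_der_linear.
- by move=> c x y; apply/funext => n; rewrite pa_kscalE arrow_derP.
- exact: arrow_derM.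
- move=> _ [c ->]; apply/funext => x.
  elim/big_ind: _ => [|f g IH IH'|i _]; first exact: arrow_der0.
    by rewrite arrow_derD IH IH' addr0.
  by rewrite arrow_derZ arrow_der_path /= scaler0.
Qed.

Lemma arrow_der_arrow a : arrow_der (pa_arrow k a) = theta a.
Proof.
by apply/funext => x; rewrite arrow_der_path /= scale1r addr0 theta_src.
Qed.

End ArrowDer.

Section VertexDer.
Variables (k : fieldType) (Q : quiver).
Local Notation A := (path_alg k Q).
Local Notation e := (@pa_idem k Q).
Variables (N M : lmodType A).
Local Notation R := (vertex_subalg k Q).

Section VertexBimodule.
Variable d : A -> kmod N -> kmod M.
Hypothesis dD : Der R N M d.

Lemma vertex_derMl i a (x : N) : d (e i * a) x = e i *: (d a x : M).
Proof. by rewrite (derM dD) (der_vanish dD _ (idem_vertex k i)) addr0. Qed.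

Lemma vertex_derMr i a (x : N) : d (a * e i) x = d a (e i *: x).
Proof.
by rewrite (derM dD) (der_vanish dD x (idem_vertex k i)) scaler0 add0r.
Qed.
End VertexBimodule.

Lemma vertex_der_ext d d' : Der R N M d -> Der R N M d' ->
  (forall a, d (pa_arrow k a) = d' (pa_arrow k a)) -> d = d'.
Proof.
move=> dD d'D eqd; apply/funext.
elim/pa_ind_arrow => [|f g IH IH'|c f IH|i|f a IH]; apply/funext => x.
- by rewrite !(der0l dD, der0l d'D).
- by rewrite !(derDl dD, derDl d'D) IH IH'.
- by rewrite -pa_kscalE !(derZl dD, derZl d'D) IH.
- by rewrite !(der_vanish dD, der_vanish d'D) //; exact: idem_vertex.
- by rewrite !(derM dD, derM d'D) eqd IH.
Qed.

End VertexDer.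

Section PathAlgebraDer.
Variables (k : fieldType) (Q : quiver).
Local Notation A := (path_alg k Q).
Local Notation e := (@pa_idem k Q).
Local Notation R := (vertex_subalg k Q).

(** Right exactness of Ext^1(N, -) over the path algebra: choose linear lifts of
    the values of d at the arrows, cut them down by the idempotents at both
    ends, and extend them freely. *)
Lemma Der_lift (N X M : lmodType A) (pi : {linear X -> M}) d :
    fin_dim N -> (forall m, exists x, pi x = m) -> Der R N M d ->
  exists2 d', Der R N X d' & forall a x, d a x = pi (d' a x).
Proof.
move=> [n hN] pi_surj dD.
have /choice [h hP] : forall al : arrow Q, exists h : kmod N -> kmod X,
    linear h /\ forall x, pi (h x) = d (pa_arrow k al) x.
  move=> al.
  have [||x|h hL hE] := @linear_selection _ _ (kmod X) _
    (fun x y => pi y = d (pa_arrow k al) x) hN.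
  - by rewrite linear0 (der0r dD).
  - by move=> c x y x' y' xx' yy'; rewrite linearP xx' yy' (der_linear dD).
  - exact: pi_surj.
  - by exists h.
pose theta al (x : kmod N) : kmod X :=
  e (tgt al) *: (h al (e (src al) *: (x : N)) : X).
have thetaL al : linear (theta al).
  move=> c x y; rewrite /theta scalerDr kscaleZ (hP al).1 scalerDr.
  by rewrite kscaleZ.
have idemZ i (Y : lmodType A) (y : Y) : e i *: (e i *: y) = e i *: y.
  by rewrite scalerA idem_idemM eqxx.
have theta_tgt al (x : N) : e (tgt al) *: (theta al x : X) = theta al x.
  exact: idemZ.
have theta_src al (x : N) : theta al (e (src al) *: x) = theta al x.
  by rewrite /theta idemZ.
have d'D := arrow_der_Der thetaL theta_tgt.
exists (arrow_der theta) => // a x.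
suff -> : d = fun a x => pi (arrow_der theta a x) by [].
apply: (vertex_der_ext dD (Der_post pi d'D)) => al.
apply/funext => y; rewrite arrow_der_arrow // /theta linearZ /= (hP al).2.
by rewrite -(vertex_derMr dD) arrow_idemM -(vertex_derMl dD) idem_arrowM.
Qed.

(** A derivation is determined by its values on the arrows, which are finitely
    many linear maps between finite-dimensional spaces. *)
Lemma fin_dim_Der (N M : lmodType A) : fin_dim N -> fin_dim M ->
  exists d, has_dim (Der R N M) d.
Proof.
move=> [n /has_dim_coord [bN [coN coNE]]] [m /has_dim_coord [bM [coM coME]]].
pose iota (d : A -> kmod N -> kmod M) : {ffun arrow Q -> 'M[k]_(n, m)} :=
  [ffun al => \matrix_(i, j) coM (d (pa_arrow k al) (bN i)) 0 j].
have iotaL : linear iota.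
  move=> c d d'; apply/ffunP => al; rewrite !ffunE; apply/matrixP => i j.
  rewrite !mxE -[(c *: d + d') _ _]/(c *: d (pa_arrow k al) (bN i) +
    d' (pa_arrow k al) (bN i)).
  by rewrite linearP !mxE.
apply: (fin_subspace (iota := mklinear iotaL)).
- exact: Der0.
- by move=> c d d'; apply: Der_linear_comb.
- move=> d dD d0; apply: (vertex_der_ext dD (Der0 _ _ _)) => al.
  apply/funext => x.
  rewrite [x]coNE.
  elim/big_ind: _ => [|u v uz vz|i _]; first exact: (der0r dD).
    by rewrite (derDr dD) uz vz addr0.
  rewrite (derZr dD) (_ : d _ _ = 0) ?scaler0 //.
  rewrite [LHS]coME big1 // => j _.
  have /ffunP/(_ al)/matrixP/(_ i j) : iota d = 0 by [].
  by rewrite !ffunE !mxE => ->; rewrite scale0r.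
Qed.

End PathAlgebraDer.

Lemma fin_dim_Hom (k : fieldType) (A : kAlgType k) (T M : lmodType A) :
  fin_dim T -> fin_dim M -> exists d, has_dim (Defs.Hom T M) d.
Proof.
move=> [n /has_dim_coord [bN [coN coNE]]] [m /has_dim_coord [bM [coM coME]]].
pose iota (p : T -> kmod M) : 'M[k]_(n, m) :=
  \matrix_(i, j) coM (p (bN i)) 0 j.
have iotaL : linear iota.
  move=> c d d'; apply/matrixP => i j.
  rewrite !mxE -[(c *: d + d') _]/(c *: d (bN i) + d' (bN i)).
  by rewrite linearP !mxE.
apply: (fin_subspace (iota := mklinear iotaL)).
- by move=> a x y /=; rewrite scaler0 addr0.
- move=> c p q pL qL a x y.
  rewrite -[LHS]/(c *: (p _) + q _).
  rewrite -[RHS]/(a *: (c *: p x + q x : M) + (c *: p y + q y)).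
  have -> : p (a *: x + y) = a *: (p x : M) + p y by apply: pL.
  have -> : q (a *: x + y) = a *: (q x : M) + q y by apply: qL.
  rewrite scalerDr [in RHS]scalerDr [LHS]addrACA; congr (_ + _ + _).
  exact: kscale_scaleC.
- move=> p pL p0; apply/funext => x.
  have pkL : linear (p : kmod T -> kmod M) by apply: linear_kmod.
  have pD := linear_funD pkL; have pZ := linear_funZ pkL.
  rewrite [x]coNE.
  elim/big_ind: _ => [|u v uz vz|i _]; first exact: (linear_fun0 pkL).
    by rewrite pD uz vz addr0.
  rewrite pZ (_ : p _ = 0) ?scaler0 //.
  rewrite [LHS]coME big1 // => j _.
  have /matrixP/(_ i j) : iota p = 0 by [].
  by rewrite !mxE => ->; rewrite scale0r.
Qed.

(** * Derivations of the one-point extension *)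

Section Pure.
Variables (k : fieldType) (A : kAlgType k) (T : lmodType A) (V : lmodType k).

Lemma pure0l (v : V) : pure (0 : T) v = 0.
Proof. by rewrite -(scale0r (0 : T)) pure_scale scale0r. Qed.

Lemma pure0r (t : T) : pure t (0 : V) = 0.
Proof. by apply: (addrI (pure t 0)); rewrite -pureDr !addr0. Qed.

Lemma pure_linearl (v : V) : linear (fun t : T => pure t v).
Proof. by move=> a t t'; rewrite pureDl pure_scale. Qed.

End Pure.

Section TripleDer.
Variables (k : fieldType) (Q : quiver).
Local Notation A := (path_alg k Q).
Local Notation R := (vertex_subalg k Q).
Variables (T M N : lmodType A) (V W : lmodType k).
Variables (f : {linear tensor T V -> M}) (g : {linear tensor T W -> N}).
Local Notation B := (opext T).
Local Notation Rx := (ext_vertex_subalg T).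
Local Notation Mx := (triple_mod f).
Local Notation Nx := (triple_mod g).

(** The restrictions d to A and s to T of one derivation of A[T]; the last
    condition is the Leibniz rule for the product of A and T. *)
Definition compatible (d : A -> kmod N -> kmod M) (s : T -> W -> kmod M) :
    Prop :=
  [/\ forall t, linear (s t),
      forall (w : W) (c : k) (t t' : kmod T),
        s (c *: t + t') w = c *: s t w + s t' w &
      forall a (t : T) w, s (a *: t) w = a *: (s t w : M) + d a (g (pure t w))].

Lemma compatible_point0 d s t : compatible d s -> s t 0 = 0.
Proof.
by move=> [sL _ _]; exact: (linear_fun0 (sL t)).
Qed.

Lemma compatible_comb (c : k) d s d' s' : compatible d s -> compatible d' s' ->
  compatible (c *: d + d') (c *: s + s').
Proof.
move=> [sL sLt sM] [s'L s'Lt s'M]; split=> [t b w w'|w b t t'|a t w].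
- rewrite -[LHS]/(c *: s t _ + s' t _).
  rewrite -[RHS]/(b *: (c *: s t w + s' t w) + (c *: s t w' + s' t w')).
  by rewrite sL s'L !scalerDr !scalerA [b * c]mulrC addrACA.
- rewrite -[LHS]/(c *: s _ _ + s' _ _).
  rewrite -[RHS]/(b *: (c *: s t w + s' t w) + (c *: s t' w + s' t' w)).
  by rewrite sLt s'Lt !scalerDr !scalerA [b * c]mulrC addrACA.
- rewrite -[LHS]/(c *: s _ _ + s' _ _).
  rewrite -[RHS]/(a *: (c *: s t w + s' t w : M) +
    (c *: d a (g (pure t w)) + d' a (g (pure t w)))).
  rewrite sM s'M !scalerDr [LHS]addrACA; congr (_ + _ + _).
  exact: kscale_scaleC.
Qed.

Lemma compatible0 : compatible 0 0.
Proof.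
by split=> [t c w w'|w c t t'|a t w]; rewrite /= ?scaler0 addr0.
Qed.

Lemma compatible_sum (I : finType) (c : I -> k) d s :
  (forall i, compatible (d i) (s i)) ->
  compatible (\sum_i c i *: d i) (\sum_i c i *: s i).
Proof.
move=> ds; elim/big_rec2: _ => [|i y x _ xy]; first exact: compatible0.
exact: compatible_comb.
Qed.

(** For fixed w the required s(-, w) exhibits the derivation
    a |-> d(a) (g (- (x) w)) as inner; the choice is made linear in w. *)
Lemma compatible_exists nW d : has_dim [set: W] nW -> Der R N M d ->
    (forall d', Der R T M d' -> inner_der d') ->
  exists s, compatible d s.
Proof.
move=> hW dD inner.
pose rel (w : W) (h : kmod T -> kmod M) := linear h /\
  forall a (t : T), d a (g (pure t w)) = h (a *: t) - a *: (h t : M).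
have [||w|H HL HP] := @linear_selection _ _ _ _ rel hW.
- split=> [c x y|a t]; first by rewrite /= scaler0 addr0.
  by rewrite pure0r linear0 (der0r dD) /= scaler0 subr0.
- move=> c w w' h h' [hL hE] [h'L h'E]; split=> [b x y|a t].
    rewrite -[LHS]/(c *: h _ + h' _).
    rewrite -[RHS]/(b *: (c *: h x + h' x) + (c *: h y + h' y)).
    by rewrite hL h'L !scalerDr !scalerA [b * c]mulrC addrACA.
  have -> : pure t (c *: w + w') = pure (c *: (t : kmod T) : T) w + pure t w'.
    by rewrite pureDr pure_kscale.
  rewrite pure_scale linearD linearZ /= (derDr dD) [d a (_ *: _)](derZr dD).
  rewrite hE h'E -[RHS]/((c *: h (a *: t) + h' (a *: t)) -
    a *: (c *: h t + h' t : M)).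
  rewrite (scalerDr a) opprD scalerBr [RHS]addrACA; congr (_ - _ + _).
  exact: kscale_scaleC.
- pose gw : {linear T -> N} := mklinear (fun (a : A) (t t' : T) =>
    etrans (congr1 g (pure_linearl w a t t')) (linearP g a _ _)).
  have [h hL hE] := inner _ (Der_comp gw dD).
  by exists h; split=> // a t; rewrite -hE.
exists (fun t w => H w t); split=> [t c w w'|w c t t'|a t w].
- by rewrite HL.
- by rewrite (HP w).1.
- by rewrite (HP w).2 addrC subrK.
Qed.

Definition triple_der (d : A -> kmod N -> kmod M) (s : T -> W -> kmod M) :
    B -> kmod Nx -> kmod Mx :=
  fun x u => let: (a, t, _) := x in (d a u.1 + s t u.2, 0).

Lemma triple_kscaleE (c : k) (u : kmod Mx) :
  c *: u = (c *: (u.1 : kmod M), c *: u.2) :> M * V.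
Proof.
by rewrite kscaleE; congr (_, _); rewrite /= pure0l linear0 addr0.
Qed.

Lemma triple_kscaleE' (c : k) (u : kmod Nx) :
  c *: u = (c *: (u.1 : kmod N), c *: u.2) :> N * W.
Proof.
by rewrite kscaleE; congr (_, _); rewrite /= pure0l linear0 addr0.
Qed.

Lemma triple_fstP (c : k) (u v : kmod Mx) :
  (c *: u + v).1 = c *: (u.1 : kmod M) + v.1.
Proof. by rewrite [c *: u]triple_kscaleE. Qed.

Lemma triple_der_Der d s : Der R N M d -> compatible d s ->
  Der Rx Nx Mx (triple_der d s).
Proof.
move=> dD [sL sLt sM].
have s0 w : s 0 w = 0 by exact: (linear_fun0 (sLt w)).
have sD t t' w : s (t + t') w = s t w + s t' w by exact: (linear_funD (sLt w)).
split.
- move=> [[a t] l] c x y.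
  rewrite [c *: x]triple_kscaleE' [c *: triple_der _ _ _ _]triple_kscaleE.
  congr (_, _); last by rewrite /= scaler0 addr0.
  rewrite -[LHS]/(d a (c *: (x.1 : kmod N) + (y.1 : kmod N)) +
    s t (c *: x.2 + y.2)).
  by rewrite (der_linear dD) sL scalerDr addrACA.
- move=> c [[a t] l] [[a' t'] l']; apply/funext => u.
  rewrite -[RHS]/(c *: triple_der d s (a, t, l) u +
    triple_der d s (a', t', l') u).
  rewrite [c *: triple_der _ _ _ _]triple_kscaleE.
  congr (_, _) => /=; last by rewrite scaler0 addr0.
  rewrite scaler0 addr0 (der_lin dD) sLt.
  by rewrite scalerDr addrACA.
- move=> [[a t] l] [[a' t'] l'] [n w].
  congr (_, _) => /=; last by rewrite scaler0 addr0.
  rewrite (derM dD) sD sM.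
  rewrite pure0r linear0 addr0 scalerDr (derDr dD).
  have -> : s (l' *: (t : kmod T)) w = s t (l' *: w).
    by rewrite (linear_funZ (sL t)) (linear_funZ (sLt w)).
  by rewrite -!addrA; congr (_ + _); rewrite addrCA.
- move=> _ [c [l ->]]; apply/funext => u.
  have -> : \sum_i kscal (c i) * opmx (pa_idem k i) 0 0 + kscal l * opmx 0 0 1 =
      opmx (\sum_i c i *: pa_idem k i) 0 l :> B.
    have sE : \sum_i kscal (c i) * opmx (pa_idem k i) 0 0 =
        opmx (\sum_i c i *: pa_idem k i) 0 0 :> B.
      elim/big_rec2: _ => // i y x _ ->.
      congr (_, _, _); rewrite /= ?pa_kscalE //.
        by rewrite !scaler0 !addr0.
      by rewrite mulr0 addr0.
    rewrite sE; congr (_, _, _); rewrite /= ?mulr0 ?addr0 //.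
      by rewrite !scaler0 !addr0.
    by rewrite mulr1 add0r.
  congr (_, _); rewrite /= s0 addr0 (der_vanish dD) //.
  by exists c.
Qed.

Lemma idem_split (a : A) (t : T) (l : k) :
  opmx a t l = opmx 1 0 0 * (opmx a 0 0 * opmx 1 0 0) +
    opmx 1 0 0 * (opmx 0 t 0 * opmx 0 0 1) + kscal l * opmx 0 0 1 :> B.
Proof.
congr (_, _, _); rewrite /= ?(mulr1, mul1r, mulr0, mul0r, addr0, add0r) //.
by rewrite !(scaler0, scale0r, scale1r, addr0, add0r).
Qed.

Lemma ext_vertex_unit : Rx (opmx 1 0 0).
Proof.
exists (fun=> 1), 0; rewrite (_ : kscal 0 * _ = 0); last first.
  by congr (_, _, _); rewrite /= ?mulr0 ?mul0r // !scaler0 add0r.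
rewrite addr0; transitivity (\sum_i opmx (pa_idem k i) 0 0 : B).
  rewrite -[1 in LHS](sum_idem k Q).
  by elim/big_rec2: _ => // i y x _ <-; congr (_, _, _); rewrite /= addr0.
by apply: eq_bigr => i _; rewrite kscal1 mul1r.
Qed.

Lemma ext_vertex_idem i : Rx (opmx (pa_idem k i) 0 0).
Proof.
exists (fun j => (j == i)%:R), 0.
rewrite (_ : kscal 0 * _ = 0); last first.
  by congr (_, _, _); rewrite /= ?mulr0 ?mul0r // !scaler0 add0r.
rewrite addr0 (bigD1 i) //= eqxx kscal1 mul1r big1 ?addr0 //.
move=> j /negbTE ->; congr (_, _, _).
- by rewrite /= pa_kscalE scale0r.
- by rewrite /= !scaler0 addr0.
- by rewrite /= mulr0.
Qed.

Lemma ext_vertex_point : Rx (opmx 0 0 1).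
Proof.
exists (fun=> 0), 1; rewrite big1 ?add0r ?kscal1 ?mul1r // => i _.
congr (_, _, _).
- by rewrite /= pa_kscalE scale0r.
- by rewrite /= !scaler0 addr0.
- by rewrite /= mulr0.
Qed.

(** The Peirce decomposition of A[T] with respect to the idempotents [1 0; 0 0]
    and [0 0; 0 1], on which D vanishes: D maps the block A into Hom(N, M), the
    block T into Hom(W, M), and kills the remaining block. *)
Lemma triple_der_surj D : Der Rx Nx Mx D ->
  exists d s, [/\ Der R N M d, compatible d s & D = triple_der d s].
Proof.
move=> DD.
have unitM b (u : Nx) : D (opmx 1 0 0 * b) u = ((D b u).1, 0).
  rewrite (derM DD) (der_vanish DD _ ext_vertex_unit) addr0; congr (_, _).
    by rewrite /= scale1r pure0l linear0 addr0.
  by rewrite /= scale0r.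
have Munit b n w : D (b * opmx 1 0 0) (n, w) = D b ((n, 0) : Nx).
  rewrite (derM DD) (der_vanish DD _ ext_vertex_unit) scaler0 add0r.
  congr (D b _); congr (_, _); rewrite /= ?scale0r //.
  by rewrite scale1r pure0l linear0 addr0.
have Mpoint b n w : D (b * opmx 0 0 1) (n, w) = D b ((0, w) : Nx).
  rewrite (derM DD) (der_vanish DD _ ext_vertex_point) scaler0 add0r.
  congr (D b _); congr (_, _); rewrite /= ?scale1r //.
  by rewrite scale0r pure0l linear0 addr0.
have pointZ l (u : Nx) : D (kscal l * opmx 0 0 1) u = 0.
  by rewrite (derZl DD) (der_vanish DD _ ext_vertex_point) scaler0.
pose d a (n : kmod N) : kmod M := (D (opmx a 0 0) ((n, 0) : Nx)).1.
pose s t (w : W) : kmod M := (D (opmx 0 t 0) ((0, w) : Nx)).1.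
have DE : D = triple_der d s.
  apply/funext => -[[a t] l]; apply/funext => -[n w].
  rewrite [in LHS](idem_split a t l : (a, t, l) = _) !(derDl DD) pointZ addr0.
  by rewrite !unitM Munit Mpoint; congr (_, _); rewrite /= addr0.
exists d, s; split=> //.
- split=> [a c n n'|c a b|a b n|_ [c ->]].
  + rewrite /d -triple_fstP -(der_linear DD); congr (D _ _).1.
    by rewrite triple_kscaleE'; congr (_, _); rewrite /= scaler0 addr0.
  + apply/funext => n; rewrite -[RHS]/(c *: d a n + d b n) /d.
    rewrite -triple_fstP -(der_lin DD).
    congr (D _ _).1; congr (_, _, _); rewrite /= ?mulr0 ?addr0 //.
    by rewrite !scaler0 addr0.
  + have mE : opmx (a * b) 0 0 = opmx a 0 0 * opmx b 0 0 :> B.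
      by congr (_, _, _); rewrite /= ?mulr0 // !scaler0 addr0.
    rewrite /d mE (derM DD) -[LHS]/((_ : Mx).1 + (_ : Mx).1).
    congr (_ + (D _ _).1); first by rewrite /= pure0l linear0 addr0.
    by congr (_, _); rewrite /= ?scale0r // pure0l linear0 addr0.
  + apply/funext => n; rewrite /d.
    suff -> : forall m, D (opmx (\sum_i c i *: pa_idem k i) 0 0) m = 0 by [].
    move=> m; have -> : opmx (\sum_i c i *: pa_idem k i) 0 0 =
        \sum_i kscal (c i) * opmx (pa_idem k i) 0 0 :> B.
      elim/big_rec2: _ => // i y x _ <-.
      congr (_, _, _); rewrite /= ?pa_kscalE ?mulr0 ?addr0 //.
      by rewrite !scaler0 !addr0.
    elim/big_ind: _ => [|x y x0 y0|i _]; first exact: (der0l DD).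
      by rewrite (derDl DD) x0 y0 addr0.
    by rewrite (derZl DD) (der_vanish DD _ (ext_vertex_idem i)) scaler0.
- split=> [t c w w'|w c t t'|a t w].
  + rewrite /s -triple_fstP -(der_linear DD); congr (D _ _).1.
    by rewrite triple_kscaleE'; congr (_, _); rewrite /= scaler0 addr0.
  + rewrite /s -triple_fstP -(der_lin DD).
    congr (D _ _).1; congr (_, _, _); rewrite /= ?mulr0 ?addr0 //.
    by rewrite scale0r addr0.
  + have mE : opmx 0 (a *: t) 0 = opmx a 0 0 * opmx 0 t 0 :> B.
      by congr (_, _, _); rewrite /= ?mulr0 // scaler0 addr0.
    rewrite /s mE (derM DD) -[LHS]/((_ : Mx).1 + (_ : Mx).1).
    congr (_ + (D _ _).1); first by rewrite /= pure0l linear0 addr0.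
    by congr (_, _); rewrite /= ?scale0r // add0r.
Qed.

Lemma triple_derP (c : k) d s d' s' :
  triple_der (c *: d + d') (c *: s + s') =
  c *: triple_der d s + triple_der d' s'.
Proof.
apply/funext => -[[a t] l]; apply/funext => u.
rewrite -[RHS]/(c *: triple_der d s (a, t, l) u + triple_der d' s' (a, t, l) u).
rewrite [c *: triple_der _ _ _ _]triple_kscaleE.
congr (_, _); last by rewrite /= scaler0 addr0.
rewrite -[LHS]/((c *: d a u.1 + d' a u.1) + (c *: s t u.2 + s' t u.2)).
by rewrite /= scalerDr addrACA.
Qed.

Lemma triple_der0 : triple_der 0 0 = 0.
Proof.
apply/funext => -[[a t] l]; apply/funext => u.
by congr (_, _); rewrite /= addr0.
Qed.

Lemma triple_der_sum (I : finType) (c : I -> k) d s :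
  triple_der (\sum_i c i *: d i) (\sum_i c i *: s i) =
  \sum_i c i *: triple_der (d i) (s i).
Proof.
elim/big_rec3: _ => [|i x y z _ <-]; first exact: triple_der0.
exact: triple_derP.
Qed.

Lemma triple_der_inj d s d' s' : Der R N M d -> Der R N M d' ->
    compatible d s -> compatible d' s' ->
  triple_der d s = triple_der d' s' -> d = d' /\ s = s'.
Proof.
move=> dD d'D ds d's' eqds; split.
  apply/funext => a; apply/funext => n.
  have := congr1 (fun D => (D (opmx a 0 0) ((n, 0) : Nx)).1) eqds.
  by rewrite /= (compatible_point0 _ ds) (compatible_point0 _ d's') !addr0.
apply/funext => t; apply/funext => w.
have := congr1 (fun D => (D (opmx 0 t 0) ((0, w) : Nx)).1) eqds.
by rewrite /= (der0l dD) (der0l d'D) !add0r.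
Qed.

End TripleDer.
Arguments triple_der {k Q T M N V W} f g d s.

(** * Vanishing of the first extension group of T by a quotient of T^n *)

(** Each component of a lift to T^n is inner, and the image under pi of the
    family of the maps h_i makes the given derivation inner. *)
Lemma quotient_derivation_inner (k : fieldType) (Q : quiver)
    (T M : lmodType (path_alg k Q)) n (pi : {linear {ffun 'I_n -> T} -> M}) :
    fin_dim T -> ext_dim 1 T T 0 -> (forall m, exists x, pi x = m) ->
  forall d, Der (vertex_subalg k Q) T M d -> inner_der d.
Proof.
move=> hT hExt pi_surj d dD.
have [d' d'D dE] := Der_lift hT pi_surj dD.
have evL i : linear (fun x : {ffun 'I_n -> T} => x i).
  by move=> a x y; rewrite !ffunE.
have /choice [h hP] : forall i, exists h : kmod T -> kmod T, linear h /\
    forall a (x : T), d' a x i = h (a *: x) - a *: (h x : T).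
  move=> i.
  have [h hL hE] := derivation_inner hExt (Der_post (mklinear (evL i)) d'D).
  by exists h.
exists (fun x => pi [ffun i => h i x]) => [c x y|a x].
  rewrite [X in _ = X + _]kscaleE -linearP; congr (pi _).
  by apply/ffunP => i; rewrite !ffunE (hP i).1.
rewrite dE -linearZ -linearB; congr (pi _); apply/ffunP => i.
by rewrite !ffunE (hP i).2.
Qed.

Lemma full_quotient (k : fieldType) (A : kAlgType k) (T M : lmodType A)
    (V : vectType k) (f : {linear tensor T V -> M}) : full f ->
  exists pi : {linear {ffun 'I_(\dim (fullv : {vspace V})) -> T} -> M},
    forall m, exists x, pi x = m.
Proof.
move=> hf; pose v i := (vbasis {:V})`_i.
pose pi (x : {ffun 'I_(\dim {:V}) -> T}) : M := f (\sum_i pure (x i) (v i)).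
have piL : linear pi.
  move=> a x y; rewrite /pi -linearP; congr (f _).
  rewrite scaler_sumr -big_split; apply: eq_bigr => i _ /=.
  by rewrite !ffunE pureDl pure_scale.
exists (mklinear piL) => m; have [z <-] := hf m.
have [s ->] := tensor_sum z.
elim: s => [|[t u] s [x xE]].
  by exists 0; rewrite linear0 big_nil linear0.
exists (x + [ffun i => coord (vbasis {:V}) i u *: (t : kmod T) : T]).
rewrite linearD xE big_cons linearD addrC; congr (_ + _).
rewrite /= /pi; congr (f _); rewrite {2}(coord_vbasis (memvf u)).
under eq_bigr do rewrite ffunE pure_kscale.
elim/big_rec2: _ => [|i y z' _ ->]; first by rewrite pure0r.
by rewrite pureDr.
Qed.

(** A k-linear section h of the augmentation becomes R-linear when replaced by
    the sum of the e_i h e_i. *)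
Lemma vertex_section (k : fieldType) (Q : quiver)
    (T : lmodType (path_alg k Q)) (P : proj_resolution T) : fin_dim T ->
  exists sigma : kmod T -> kmod (pr_obj P 0), [/\ linear sigma,
    forall x, pr_aug P (sigma x) = x &
    forall s (x : T), vertex_subalg k Q s ->
      sigma (s *: x) = s *: (sigma x : pr_obj P 0)].
Proof.
move=> [n hT].
have [||x|h hL hP] := @linear_selection _ (kmod T) (kmod (pr_obj P 0)) _
  (fun x y => pr_aug P y = x) hT.
- exact: linear0.
- by move=> c x y x' y' <- <-; rewrite linearP.
- exact: pr_aug_surj.
pose e := @pa_idem k Q.
pose sg (x : kmod T) : kmod (pr_obj P 0) :=
  \sum_i e i *: (h (e i *: (x : T)) : pr_obj P 0).
have sgL : linear sg.
  move=> c x y; rewrite /sg scaler_sumr -big_split; apply: eq_bigr => i _ /=.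
  by rewrite scalerDr kscaleZ hL scalerDr kscaleZ.
exists sg; split=> // [x|_ x [c ->]].
- rewrite /sg linear_sum /=.
  under eq_bigr do rewrite linearZ /= hP scalerA idem_idemM eqxx.
  by rewrite -scaler_suml sum_idem scale1r.
- rewrite /sg scaler_sumr; apply: eq_bigr => i _.
  rewrite !scalerA idem_vertexM vertex_idemM !scale_actE.
  by rewrite (linear_funZ hL) kscaleZ.
Qed.

(** * The dimension count *)

Section DimensionCount.
Variables (k : fieldType) (Q : quiver).
Local Notation A := (path_alg k Q).
Local Notation R := (vertex_subalg k Q).
Variables (T M N : lmodType A) (V : lmodType k) (W : vectType k).
Variables (f : {linear tensor T V -> M}) (g : {linear tensor T W -> N}).
Hypothesis inner : forall d, Der R T M d -> inner_der d.

(** A basis of Der(A[T], ...): lifts (b_i, sb_i) of the basis vectors b_i of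
    Der(A, ...), together with the pairs (0, co_i p_j) for the coordinate
    functions co_i of a basis of W and a basis (p_j) of Hom_A(T, M). *)
Lemma has_dim_triple_Der dA h :
    has_dim (Der R N M) dA -> has_dim (Defs.Hom T M) h ->
  has_dim (Der (ext_vertex_subalg T) (triple_mod g) (triple_mod f))
    (dA + \dim {:W} * h).
Proof.
move=> /(has_dim_basisP (Der0 _ _ _)) [b [bD bspan bfree]].
have Hom0 : Defs.Hom T M 0 by move=> a x y /=; rewrite scaler0 addr0.
move=> /(has_dim_basisP Hom0) [p [pH pspan pfree]].
set nW := \dim _.
pose w (i : 'I_nW) := (vbasis {:W})`_i.
pose co (i : 'I_nW) (x : W) := coord (vbasis {:W}) i x.
have wE x : x = \sum_i co i x *: w i by exact: coord_vbasis (memvf x).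
have cow i j : co i (w j) = (i == j)%:R.
  by rewrite /co coord_free ?(basis_free (vbasisP _)) // eq_sym.
have /choice [sb sbP] : forall i, exists s, compatible g (b i) s.
  by move=> i; apply: compatible_exists (has_dim_vectType W) (bD i) inner.
pose I : finType := ('I_dA + 'I_nW * 'I_h)%type.
have -> : (dA + nW * h)%N = #|I| by rewrite card_sum card_prod !card_ord.
pose dd (x : I) := if x is inl i then b i else 0.
pose ss (x : I) : T -> W -> kmod M := match x with
  | inl i => sb i
  | inr (i, j) => fun t u => co i u *: p j t end.
have pkL j : linear (p j : kmod T -> kmod M) by apply: linear_kmod; apply: pH.
have ddD x : Der R N M (dd x) by case: x => [i|ij]; [apply: bD | apply: Der0].
have ddss x : compatible g (dd x) (ss x).
  case: x => [i|[i j]] /=; first exact: sbP.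
  split=> [t c u u'|u c t t'|a t u].
  - by rewrite /co linearP /= scalerDl scalerA.
  - by rewrite pkL scalerDr !scalerA mulrC.
  - rewrite addr0 kscaleZ; congr (_ *: _).
    exact: (linear_funZ (pH j : linear (p j : T -> M))).
have sum_dd c : \sum_x c x *: dd x = \sum_i c (inl i) *: b i.
  rewrite /I big_sumType /= [X in _ + X]big1 ?addr0 // => ij _.
  exact: scaler0.
have sum_ss c t u : (\sum_x c x *: ss x) t u =
    (\sum_i c (inl i) *: sb i) t u +
    \sum_i co i u *: (\sum_j c (inr (i, j)) *: p j) t.
  rewrite /I big_sumType /=.
  rewrite -[LHS]/((_ : T -> W -> kmod M) t u + (_ : T -> W -> kmod M) t u).
  congr (_ + _); rewrite !fct_sumE.
  transitivity (\sum_i \sum_j co i u *: (c (inr (i, j)) *: p j t)).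
    rewrite pair_bigA; apply: eq_bigr => -[i j] _ /=.
    rewrite -[LHS]/(c (inr (i, j)) *: (co i u *: p j t)).
    by rewrite !scalerA mulrC.
  by apply: eq_bigr => i _; rewrite -scaler_sumr fct_sumE.
have dd_Der c : Der R N M (\sum_x c x *: dd x).
  elim/big_rec: _ => [|x y _ yD]; first exact: Der0.
  exact: Der_linear_comb.
apply: (@has_dim_basis _ _ _ I (fun x => triple_der f g (dd x) (ss x))).
- by move=> x; apply: triple_der_Der.
- move=> _ /triple_der_surj [d [s [dD ds ->]]].
  have [c dE] := bspan d dD.
  pose s0 := s - \sum_i c i *: sb i.
  have [s0L s0Lt s0M] : compatible g 0 s0.
    have := compatible_comb (-1) (compatible_sum c sbP) ds.
    by rewrite -dE !scaleN1r addNr addrC.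
  have /choice [q qE] : forall i, exists q : 'I_h -> k,
      (fun t => s0 t (w i)) = \sum_j q j *: p j.
    move=> i; apply: pspan => a t t'.
    have -> : s0 (a *: t + t') (w i) = s0 (a *: t) (w i) + s0 t' (w i).
      by have := s0Lt (w i) 1 (a *: t) t'; rewrite !scale1r.
    by rewrite s0M addr0.
  exists (fun x => match x with inl i => c i | inr (i, j) => q i j end).
  rewrite -triple_der_sum sum_dd -dE; congr (triple_der f g _ _).
  apply/funext => t; apply/funext => u; rewrite sum_ss.
  apply/eqP; rewrite addrC -subr_eq; apply/eqP.
  rewrite -[LHS]/(s0 t u) {1}[u]wE.
  have s0t := s0L t.
  rewrite -[LHS]/(mklinear s0t _) linear_sum; apply: eq_bigr => i _.
  by rewrite linearZ /= -qE.
- move=> c; rewrite -triple_der_sum -(triple_der0 f g) => c0.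
  have [||||d0 s0] := triple_der_inj _ _ _ _ c0.
  - exact: dd_Der.
  - exact: Der0.
  - exact: compatible_sum.
  - exact: compatible0.
  have cl i : c (inl i) = 0.
    by apply: (bfree (fun i => c (inl i))); rewrite -sum_dd.
  have cr i : \sum_j c (inr (i, j)) *: p j = 0.
    apply/funext => t.
    have sb0 : \sum_i c (inl i) *: sb i = 0.
      by apply: big1 => j _; rewrite cl scale0r.
    have := congr1 (fun s => s t (w i)) s0; rewrite /= sum_ss sb0 [LHS]add0r.
    rewrite (bigD1 i) //= cow eqxx scale1r [X in _ + X]big1 ?[LHS]addr0 //.
    by move=> j /negbTE ji; rewrite cow ji scale0r.
  by case=> [i|[i j]]; [exact: cl | exact: pfree (cr i) j].
Qed.

End DimensionCount.

Theorem corollary3p8 (k : closedFieldType) (Q : quiver)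
    (T : lmodType (path_alg k Q)) (hT : fin_dim T) (hExt : ext_dim 1 T T 0)
    (M : lmodType (path_alg k Q)) (hM : fin_dim M)
    (V : vectType k) (f : {linear tensor T V -> M}) (hf : full f)
    (N : lmodType (path_alg k Q)) (hN : fin_dim N)
    (W : vectType k) (g : {linear tensor T W -> N}) (hg : full g) :
  exists (dB dA : nat) (chi : int),
    [/\ has_dim (Der (ext_vertex_subalg T) (triple_mod g) (triple_mod f)) dB,
        has_dim (Der (vertex_subalg k Q) N M) dA,
        euler_form T M chi
      & dB%:Z = dA%:Z + (\dim (fullv : {vspace W}))%:Z * chi].
Proof.
have [pi pi_surj] := full_quotient hf.
have inner := quotient_derivation_inner hT hExt pi_surj.
have [P _] := hExt.
have [sigma [sL sK sR]] := vertex_section P hT.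
have ext0 : ext_dim 1 T M 0 := ext1_vanish sL sK sR inner.
have [dA hA] := fin_dim_Der hN hM.
have [h hh] := fin_dim_Hom hT hM.
exists (dA + \dim {:W} * h)%N, dA, h%:Z; split=> //.
- exact: has_dim_triple_Der.
- by exists h, 0%N; split=> //; rewrite subr0.
Qed.
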